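(* Let $\xi_1,\ldots,\xi_n$ be independent scalar (real-valued) random variables, each with finite support, and for $j=1,\ldots,n$ let $\mathcal{S}_j$ denote the support of $\xi_j$. Let $\mathbf{u}_1,\ldots,\mathbf{u}_n\in\mathbb{C}^d$ and set $$\sigma^2=\Big\|\sum_{i=1}^n \mathbf{Var}[\xi_i]\,(\mathbf{u}_i\mathbf{u}_i^* )^2\Big\|.$$ Then $$\min_{\varepsilon_1\in\mathcal{S}_1,\ldots,\varepsilon_n\in\mathcal{S}_n}\Big\|\sum_{i=1}^n\mathbb{E}[\xi_i]\,\mathbf{u}_i\mathbf{u}_i^*-\sum_{i=1}^n\varepsilon_i\,\mathbf{u}_i\mathbf{u}_i^*\Big\|\le 3\sigma.$$
   Context: $\|\cdot\|$ denotes the spectral (operator) norm of a matrix; $\mathbf{u}^*$ is the conjugate transpose. *)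

(* Defs.v *)
From HB Require Import structures.
From mathcomp Require Import all_boot all_order all_algebra.
From mathcomp Require Import classical_sets reals.
From mathcomp Require Import complex.
Set Implicit Arguments. Unset Strict Implicit. Unset Printing Implicit Defensive.
Import Order.TTheory GRing.Theory Num.Theory.
Local Open Scope ring_scope.
Local Open Scope classical_set_scope.

(* A real-valued random variable with finite support, given by its law:
   the support [fsupp X] (a finite duplicate-free list of reals) and the
   probability mass [fprob X x] of each atom, positive on the support and
   summing to 1.  The support of X is exactly the set of atoms [fsupp X]. *)
Record finRV (R : realType) := FinRV {
  fsupp : seq R;
  fprob : R -> R;
  fsupp_uniq : uniq fsupp;
  fprob_pos : forall x, x \in fsupp -> 0 < fprob x;
  fprob_sum1 : \sum_(x <- fsupp) fprob x = 1 }.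

Definition fexp (R : realType) (X : finRV R) : R :=
  \sum_(x <- fsupp X) fprob X x * x.
Definition fvar (R : realType) (X : finRV R) : R :=
  \sum_(x <- fsupp X) fprob X x * (x - fexp X) ^+ 2.

Definition adjmx (R : realType) m n (A : 'M[R[i]]_(m, n)) : 'M[R[i]]_(n, m) :=
  (map_mx (@conjc R) A)^T.

Definition vnorm2 (R : realType) d (x : 'cV[R[i]]_d) : R :=
  \sum_(k < d) ((complex.Re (x k 0)) ^+ 2 + (complex.Im (x k 0)) ^+ 2).

Definition opnorm (R : realType) m n (A : 'M[R[i]]_(m, n)) : R :=
  sup [set Num.sqrt (vnorm2 (A *m x)) | x in [set x : 'cV[R[i]]_n | vnorm2 x <= 1]].

Definition rk1 (R : realType) d (u : 'cV[R[i]]_d) : 'M[R[i]]_d := u *m adjmx u.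

(* Main.v *)
(* For a real multiaffine polynomial F in variables z_i, w_i with no zero in the product of
   upper half planes, L_i F = F - Var(xi_i) d_{z_i} d_{w_i} F has the same property, and real
   points satisfy the Rayleigh inequalities F_j F_k >= F F_jk.  Start from
   P(z, w) = det (3 sigma + sum_i z_i A_i) det (3 sigma + sum_i w_i A_i), where A_i = u_i u_i^* .

   Call p above F if F > 0 on p + (nonnegative orthant).  Barrier step: if p is above F, then
   p moved by delta_i in z_i and w_i is above L_i F and the ratios F_j / F (j distinct from z_i, w_i)
   do not increase, as long as delta_i is large compared with Var(xi_i) times these ratios.
   Starting at z = w = - delta with delta_i = Var(xi_i) |u_i|^2 / sigma, the origin ends up
   above L_n ... L_1 P, which is the expectation of P(xi - E xi, E xi - xi) for independent xi.

   Greedy step: the L_i are undone one at a time.  If (0, 0) is above L_i F in the variables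
   z_i, w_i, then L_i F = E F(e, - e) at that point for e = xi_i - E xi_i, so F(e, - e) > 0 for
   some atom, and the Rayleigh inequalities force (e, - e) to be above F.  At the end
   3 sigma +- sum_i (eps_i - E xi_i) A_i are both positive definite. *)
Require Import Defs.
From HB Require Import structures.
From mathcomp Require Import all_boot all_order all_algebra.
From mathcomp Require Import boolp classical_sets reals.
From mathcomp Require Import complex.
From mathcomp Require Import zify ring lra.
Set Implicit Arguments.
Unset Strict Implicit.
Unset Printing Implicit Defensive.
Import Order.TTheory GRing.Theory Num.Theory.
Local Open Scope ring_scope.
Local Open Scope complex_scope.

(** * Multiaffine functions *)

Section MultiAffine.
Context {K : comPzRingType} {I : finType}.
Implicit Types (F : (I -> K) -> K) (v : I -> K) (i j : I) (x y : K).

Definition upd v i x : I -> K := fun k => if k == i then x else v k.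

(* The partial derivative in direction i when F is multiaffine. *)
Definition dif F i v : K := F (upd v i 1) - F (upd v i 0).

(** An interpolation identity stands in for polynomial syntax: with finitely many coordinates it
    says that [F] is a polynomial of degree at most one in each variable. *)
Definition multiaffine F :=
  forall v i x, F (upd v i x) = F (upd v i 0) + x * dif F i v.

(** This is the operator L_i, with [i], [j] the positions of z_i, w_i and [c] the variance. *)
Definition subdif c i j F v : K := F v - c * dif (dif F i) j v.

Lemma upd_same v i x : upd v i x i = x.
Proof. by rewrite /upd eqxx. Qed.

Lemma upd_other v i x k : k != i -> upd v i x k = v k.
Proof. by rewrite /upd => /negbTE ->. Qed.

Lemma upd_id v i : upd v i (v i) = v.
Proof. by apply: funext => k; rewrite /upd; case: eqP => [->|]. Qed.

Lemma upd_upd v i x y : upd (upd v i x) i y = upd v i y.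
Proof. by apply: funext => k; rewrite /upd; case: eqP. Qed.

Lemma updC v i j x y : i != j -> upd (upd v i x) j y = upd (upd v j y) i x.
Proof.
move=> ij; apply: funext => k; rewrite /upd; case: eqP => // ->.
by rewrite eq_sym (negbTE ij).
Qed.

Lemma dif_upd F i v x : dif F i (upd v i x) = dif F i v.
Proof. by rewrite /dif !upd_upd. Qed.

Lemma dif_dif F i v : dif (dif F i) i v = 0.
Proof. by rewrite [LHS]/dif !dif_upd subrr. Qed.

Lemma difC F i j v : dif (dif F i) j v = dif (dif F j) i v.
Proof.
have [->//|ij] := eqVneq i j.
by rewrite /dif !(updC _ _ _ ij); ring.
Qed.

Lemma dif_rot F i j k v :
  dif (dif (dif F k) i) j v = dif (dif (dif F i) j) k v.
Proof.
by rewrite (_ : dif (dif F k) i = dif (dif F i) k) 1?difC //; apply: funext => u; exact: difC.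
Qed.

Lemma multiaffine_dif F i : multiaffine F -> multiaffine (dif F i).
Proof.
move=> mF v j x; have [->|ij] := eqVneq i j.
  by rewrite !dif_upd dif_dif mulr0 addr0.
by rewrite /dif -!(updC _ _ _ ij) !(mF _ j x) /dif; ring.
Qed.

Lemma dif_subdif c i j F k v :
  dif (subdif c i j F) k v = dif F k v - c * dif (dif (dif F k) i) j v.
Proof.
by rewrite dif_rot /subdif [in RHS]/dif [in LHS]/dif; ring.
Qed.

Lemma multiaffine_subdif c i j F : multiaffine F -> multiaffine (subdif c i j F).
Proof.
move=> mF v k x; rewrite dif_subdif /subdif mF.
rewrite (multiaffine_dif j (multiaffine_dif i mF)) -(dif_rot F i j k v).
by ring.
Qed.

Lemma taylor F v i x : multiaffine F -> F (upd v i (v i + x)) = F v + x * dif F i v.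
Proof. by move=> mF; rewrite -[in RHS](upd_id v i) dif_upd (mF v i (v i + x)) (mF v i (v i)); ring. Qed.

(** Moves from [v] to [w] one coordinate at a time; this turns facts about a single coordinate
    direction into facts about a whole orthant. *)
Lemma upd_ind (P : (I -> K) -> Prop) v w :
  P v -> (forall u i, (forall k, u k = v k \/ u k = w k) -> u i = v i -> P u -> P (upd u i (w i))) -> P w.
Proof.
move=> Pv step.
pose mix (s : seq I) k := if k \in s then w k else v k.
have mixP s : uniq s -> P (mix s).
  elim: s => [_|i s IH /= /andP[is_ us]].
    by rewrite (_ : mix [::] = v) //; apply: funext.
  have -> : mix (i :: s) = upd (mix s) i (w i).
    by apply: funext => k; rewrite /mix /upd inE; case: eqP => [->|].
  apply: step (IH us); last by rewrite /mix (negbTE is_).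
  by move=> k; rewrite /mix; case: ifP; [right|left].
have := mixP _ (enum_uniq I).
by rewrite (_ : mix _ = w) //; apply: funext => k; rewrite /mix mem_enum.
Qed.

End MultiAffine.

(** * Rayleigh inequalities and Wronskian estimates over the reals *)

Section RealMultiAffine.
Context {R : realFieldType} {I : finType}.
Implicit Types (f : (I -> R) -> R) (p q : I -> R) (i j : I) (c x y : R).

Definition rayleigh f := forall p i j,
  i != j -> f p * dif (dif f i) j p <= dif f i p * dif f j p.

Definition above f p := forall q, (forall k, p k <= q k) -> 0 < f q.

Lemma above_le f p q : above f p -> (forall k, p k <= q k) -> above f q.
Proof. by move=> ap pq r qr; apply: ap => k; exact: le_trans (qr k). Qed.

(** Since [f] is affine in coordinate [i], a negative slope would make it negative far out in the
    orthant. *)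
Lemma dif_nonneg_above f p i : multiaffine f ->
  (forall q, (forall k, p k <= q k) -> 0 <= f q) ->
  forall q, (forall k, p k <= q k) -> 0 <= dif f i q.
Proof.
move=> mf f0 q pq; rewrite leNgt; apply/negP => d0.
have fq : 0 <= f q by exact: f0.
(* This step length brings the value of [f] to exactly -1. *)
pose x := (1 + f q) / - dif f i q.
have x0 : 0 <= x by rewrite divr_ge0 //; lra.
suff : 0 <= f (upd q i (q i + x)).
  rewrite taylor // (_ : x * _ = - (1 + f q)); first lra.
  by rewrite /x; field; rewrite lt_eqF.
apply: f0 => k; rewrite /upd; case: eqP => [->|_]; last exact: pq.
by rewrite (le_trans (pq i)) // lerDl.
Qed.

Lemma above_dif f p i q : multiaffine f -> above f p ->
  (forall k, p k <= q k) -> 0 <= dif f i q.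
Proof. by move=> mf af; apply: dif_nonneg_above => // r /af/ltW. Qed.

Lemma above_dif2 f p i j q : multiaffine f -> above f p ->
  (forall k, p k <= q k) -> 0 <= dif (dif f i) j q.
Proof.
move=> mf af; apply: dif_nonneg_above; first exact: multiaffine_dif.
by move=> r; exact: above_dif.
Qed.

Lemma above_dif3 f p i j k q : multiaffine f -> above f p ->
  (forall k, p k <= q k) -> 0 <= dif (dif (dif f i) j) k q.
Proof.
move=> mf af; apply: dif_nonneg_above; first by do 2 apply: multiaffine_dif.
by move=> r; exact: above_dif2 af.
Qed.

Definition shift2 z w p x : I -> R := upd (upd p z (p z + x)) w (p w + x).

Lemma shift2_taylor f z w p x : multiaffine f -> z != w ->
  f (shift2 z w p x) =
  f p + x * (dif f z p + dif f w p) + x ^+ 2 * dif (dif f z) w p.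
Proof.
move=> mf zw; rewrite /shift2.
have -> : p w = upd p z (p z + x) w by rewrite upd_other // eq_sym.
rewrite taylor // taylor //.
rewrite -[dif f w _]/((dif f w) (upd p z (p z + x))) taylor; last exact: multiaffine_dif.
by rewrite (difC f z w); ring.
Qed.

Lemma dif_z_shift2 f z w p x : multiaffine f -> z != w ->
  dif f z (shift2 z w p x) = dif f z p + x * dif (dif f z) w p.
Proof.
move=> mf zw; rewrite /shift2 updC // dif_upd taylor //.
exact: multiaffine_dif.
Qed.

Lemma shift2C z w p x : z != w -> shift2 z w p x = shift2 w z p x.
Proof. by move=> zw; rewrite /shift2 updC. Qed.

Lemma dif_w_shift2 f z w p x : multiaffine f -> z != w ->
  dif f w (shift2 z w p x) = dif f w p + x * dif (dif f z) w p.
Proof.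
by move=> mf zw; rewrite shift2C // dif_z_shift2 // 1?eq_sym // (difC f w z).
Qed.

(* The derivative of [dif f j / f] along the diagonal of the plane (z, w) is
   nonpositive at every real point, by the Rayleigh inequalities for (z, j) and (w, j). *)
Lemma wronskian_ge0 f z w j p x : multiaffine f -> rayleigh f ->
    z != w -> j != z -> j != w ->
  let q0 := f p in let q1 := dif f z p + dif f w p in
  let q2 := dif (dif f z) w p in
  let b0 := dif f j p in let b1 := dif (dif f j) z p + dif (dif f j) w p in
  let b2 := dif (dif (dif f j) z) w p in
  0 <= (q1 * b0 - q0 * b1) + 2 * (q2 * b0 - q0 * b2) * x
       + (q2 * b1 - q1 * b2) * x ^+ 2.
Proof.
move=> mf rf zw jz jw /=.
have mj := multiaffine_dif j mf.
have := rf (shift2 z w p x) _ _ jz; have := rf (shift2 z w p x) _ _ jw.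
rewrite !(dif_z_shift2, dif_w_shift2, shift2_taylor) //.
move: (f p) (dif f z p) (dif f w p) (dif (dif f z) w p) (dif f j p)
  (dif (dif f j) z p) (dif (dif f j) w p) (dif (dif (dif f j) z) w p).
move=> *; lra.
Qed.

Lemma quadratic_const_ge0 (a b c : R) :
  (forall x, 0 < x -> 0 <= a + b * x + c * x ^+ 2) -> 0 <= a.
Proof.
move=> h; rewrite leNgt; apply/negP => a0.
pose M := `|b| + `|c| + 1.
have M0 : 0 < M by rewrite /M; have := normr_ge0 b; have := normr_ge0 c; lra.
(* Small enough that the two higher terms add up to at most - a / 2, which leaves a negative
   value. *)
pose x := Num.min 1 (- a / (2 * M)).
have x0 : 0 < x by rewrite lt_min ltr01 divr_gt0 //; lra.
have x1 : x <= 1 by rewrite ge_min lexx.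
have xM : x * M <= - a / 2.
  rewrite -ler_pdivlMr // -mulrA -invfM; by rewrite ge_min lexx orbT.
have hb : b * x <= `|b| * x by rewrite ler_pM2r // ler_norm.
have hc : c * x ^+ 2 <= `|c| * x.
  rewrite expr2 mulrA ler_pM2r // (le_trans (ler_norm _)) // normrM (gtr0_norm x0).
  by rewrite ler_piMr.
by have := h _ x0; rewrite /M in xM; lra.
Qed.

Lemma quadratic_lead_ge0 (a b c : R) :
  (forall x, 0 < x -> 0 <= a + b * x + c * x ^+ 2) -> 0 <= c.
Proof.
move=> h; apply: (@quadratic_const_ge0 c b a) => x x0.
have xi : 0 < x^-1 by rewrite invr_gt0.
have := mulr_ge0 (h _ xi) (ltW (exprn_gt0 2 x0)).
by congr (0 <= _); field; rewrite gt_eqF.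
Qed.

(** The [q]'s and [b]'s are the Taylor coefficients of f and f_j along the diagonal of the plane (z,
    w). The right side minus the left side is d e1 - (c - d^2) e2, where e1 and 2 e2 are the first
    two coefficients of the Wronskian; [key] compares e2 with e1. *)
Lemma wronskian_combination (q0 q1 q2 b0 b1 b2 c d : R) :
  (forall x, 0 <= (q1 * b0 - q0 * b1) + 2 * (q2 * b0 - q0 * b2) * x
       + (q2 * b1 - q1 * b2) * x ^+ 2) ->
  0 < q0 -> 0 <= q1 -> 0 <= b1 -> 0 <= d ->
  (q1 = 0 -> q2 = 0) -> 0 <= q2 -> 
  (c - d ^+ 2) * q1 <= d * q0 ->
  (b0 + d * b1 + d ^+ 2 * b2 - c * b2) * q0 <=
    b0 * (q0 + d * q1 + d ^+ 2 * q2 - c * q2).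
Proof.
move=> W q0p q1p b1p dp q2z q2p cond.
set e1 := q1 * b0 - q0 * b1 in W.
set e2 := q2 * b0 - q0 * b2 in W.
have e1p : 0 <= e1 by have := W 0; rewrite mulr0 expr0n mulr0 !addr0.
suff H : (c - d ^+ 2) * e2 <= d * e1.
  by rewrite /e1 /e2 in H; nra.
(* If q1 = 0, then q2 = b1 = 0 and the Wronskian is 2 e2 x; being nonnegative for both signs of x,
   it vanishes. *)
have [q10|q1n0] := eqVneq q1 0.
  have q20 := q2z q10.
  have b10 : b1 = 0.
    move: e1p; rewrite /e1 q10 mul0r sub0r oppr_ge0 pmulr_rle0 //.
    by move=> ?; apply/eqP; rewrite eq_le b1p andbT.
  have e20 : e2 = 0.
    have := W 1; have := W (-1); rewrite /e1 q10 b10 q20; nra.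
  by rewrite e20 mulr0 mulr_ge0.
have q1gt : 0 < q1 by rewrite lt_neqAle eq_sym q1n0.
(* The Wronskian is evaluated at the zero of the linear part q0 + q1 x. *)
have key : q0 * e2 <= q1 * e1.
  have := W (- (q0 / q1)).
  have -> : e1 + 2 * e2 * - (q0 / q1) + (q2 * b1 - q1 * b2) * (- (q0 / q1)) ^+ 2
     = ((q1 * e1 - q0 * e2) * q1 - q0 * q2 * e1) / q1 ^+ 2.
    by rewrite /e1 /e2; field.
  rewrite pmulr_lge0 ?invr_gt0 ?exprn_gt0 // => h.
  have : 0 <= (q1 * e1 - q0 * e2) * q1.
    by rewrite -(subrK (q0 * q2 * e1) (_ * q1)) addr_ge0 // !mulr_ge0 // ltW.
  by rewrite pmulr_lge0 // subr_ge0.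
have e3p : 0 <= q2 * b1 - q1 * b2.
  apply: (@quadratic_lead_ge0 e1 (2 * e2)) => x _; exact: W.
have e2p : 0 <= e2.
  have : 0 <= q1 * e2.
    rewrite (_ : q1 * e2 = q0 * (q2 * b1 - q1 * b2) + q2 * e1); last by rewrite /e1 /e2; ring.
    by rewrite addr_ge0 // mulr_ge0 // ltW.
  by rewrite pmulr_rge0.
have : q1 * ((c - d ^+ 2) * e2) <= q1 * (d * e1).
  have h1 : (c - d ^+ 2) * q1 * e2 <= d * q0 * e2 by rewrite ler_wpM2r.
  have h2 : d * (q0 * e2) <= d * (q1 * e1) by rewrite ler_wpM2l.
  lra.
by rewrite ler_pM2l.
Qed.

End RealMultiAffine.

(** * Barrier and greedy steps *)

Section Barrier.
Context {R : realFieldType} {I : finType}.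
Implicit Types (f : (I -> R) -> R) (p q : I -> R) (i j : I) (c x y : R).

(** The derivative of f_j / f in coordinate i has the sign of f f_ij - f_i f_j, so the ratio
    decreases along each coordinate. The claim is cross-multiplied to avoid division. *)
Lemma barrier_decr f p q j : multiaffine f -> rayleigh f -> above f p ->
  (forall k, p k <= q k) -> dif f j q * f p <= dif f j p * f q.
Proof.
move=> mf rf af pq.
suff [] : (forall k, p k <= q k) /\ dif f j q * f p <= dif f j p * f q by [].
apply: (@upd_ind _ _ (fun q => (forall k, p k <= q k) /\
   dif f j q * f p <= dif f j p * f q) p q); first by split.
move=> u i ub ui [pu IH].
have fp : 0 < f p by exact: af.
have fu : 0 < f u by exact: af.
have jp : 0 <= dif f j p by exact: above_dif mf af _.
have ju : 0 <= dif f j u by exact: above_dif mf af _.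
have pu' k : p k <= upd u i (q i) k by rewrite /upd; case: eqP => [->|].
split=> //.
have -> : q i = u i + (q i - p i) by rewrite ui; ring.
have xi0 : 0 <= q i - p i by rewrite subr_ge0.
set x := q i - p i in xi0 *.
rewrite !taylor //; last exact: multiaffine_dif.
have step : (dif f j u + x * dif (dif f j) i u) * f u <=
            dif f j u * (f u + x * dif f i u).
  have : f u * dif (dif f j) i u <= dif f j u * dif f i u.
    have [->|ji] := eqVneq j i; first by rewrite dif_dif mulr0 -expr2 sqr_ge0.
    exact: rf.
  move/(ler_wpM2l xi0); lra.
have fx : 0 <= f u + x * dif f i u.
  by apply: addr_ge0; [exact: ltW|apply: mulr_ge0 => //; exact: above_dif mf af _].
rewrite -(ler_pM2r fu).
have := ler_wpM2r (ltW fp) step; have := ler_wpM2r fx IH; lra.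
Qed.

Lemma subdif_shift2 c f z w p x : multiaffine f -> z != w ->
  subdif c z w f (shift2 z w p x) = f p + x * (dif f z p + dif f w p)
    + x ^+ 2 * dif (dif f z) w p - c * dif (dif f z) w p.
Proof.
move=> mf zw; rewrite /subdif shift2_taylor //; congr (_ - _ * _).
by rewrite /shift2 dif_upd difC dif_upd difC.
Qed.

Section Step.
Variables (f : (I -> R) -> R) (z w : I) (c x : R).
Hypotheses (mf : multiaffine f) (rf : rayleigh f) (zw : z != w).
Hypothesis x0 : 0 <= x.

(** The size condition on the move [x]: the second-order Taylor term x^2 f_zw offsets part of c
    f_zw, so only c - x^2 has to be controlled by the ratios. *)
Local Notation cond p := ((c - x ^+ 2) * (dif f z p + dif f w p) <= x * f p).

Let cond_le p q : above f p -> (forall k, p k <= q k) -> cond p -> cond q.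
Proof.
move=> af pq; move=> cp.
have fp : 0 < f p by exact: af.
have fq : 0 < f q by exact: af.
have q1 : 0 <= dif f z q + dif f w q by rewrite addr_ge0 // (above_dif _ mf af).
have [cx|xc] := leP 0 (c - x ^+ 2); last first.
  apply: le_trans (mulr_ge0 x0 (ltW fq)); rewrite mulr_le0_ge0 //; exact: ltW.
rewrite -(ler_pM2r fp).
have h : (dif f z q + dif f w q) * f p <= (dif f z p + dif f w p) * f q.
  by have := barrier_decr z mf rf af pq; have := barrier_decr w mf rf af pq; lra.
have := ler_wpM2l cx h; have := ler_wpM2r (ltW fq) cp; lra.
Qed.

(** By Rayleigh, f f_zw <= f_z f_w <= (f_z + f_w)^2. After multiplication by f (f_z + f_w), the loss
    (c - x^2) f_zw is absorbed by the first-order term x (f_z + f_w), and [f] itself remains. *)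
Let subdif_shift2_gt0 p : above f p -> cond p -> 
  0 < subdif c z w f (shift2 z w p x).
Proof.
move=> af cp; rewrite subdif_shift2 //.
have fp : 0 < f p by exact: af.
have z0 : 0 <= dif f z p by exact: above_dif mf af _.
have w0 : 0 <= dif f w p by exact: above_dif mf af _.
have zw0 : 0 <= dif (dif f z) w p by exact: above_dif2 mf af _.
have zwr := rf p zw.
move: cp.
move: (f p) (dif f z p) (dif f w p) (dif (dif f z) w p) fp z0 w0 zw0 zwr.
move=> a b1 b2 d a0 b10 b20 d0 ad cp.
have [b0|bn0] := eqVneq (b1 + b2) 0.
  have d00 : d = 0.
    have b1z : b1 = 0 by lra.
    by rewrite b1z mul0r pmulr_rle0 // in ad; apply/eqP; rewrite eq_le ad.
  by rewrite d00 b0; lra.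
have b : 0 < b1 + b2 by rewrite lt_neqAle eq_sym bn0 addr_ge0.
rewrite -(pmulr_rgt0 _ (mulr_gt0 a0 b)).
have h1 := ler_wpM2r (mulr_ge0 (ltW a0) d0) cp.
have h2 : x * a * (a * d) <= x * a * (b1 + b2) ^+ 2.
  apply: ler_wpM2l; first by rewrite mulr_ge0 // ltW.
  nra.
have h3 : 0 < a * a * (b1 + b2) by rewrite !mulr_gt0.
lra.
Qed.

Lemma above_subdif p : above f p -> cond p -> above (subdif c z w f) (shift2 z w p x).
Proof.
move=> af cp q pq.
(* Every point above the shifted [p] is the shift of a point above [p], where [cond] still holds by
   [cond_le]. *)
have -> : q = shift2 z w (upd (upd q z (q z - x)) w (q w - x)) x.
  apply: funext => k; rewrite /shift2 /upd eqxx.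
  by case: eqP => [->|_]; [|case: eqP => [->|_] //]; rewrite ?(negbTE zw) ?eqxx ?subrK.
set r := upd _ _ _.
have pr k : p k <= r k.
  have := pq k; rewrite /shift2 /r /upd.
  case: eqP => [->|_]; first by rewrite lerBrDr.
  by case: eqP => [->|_] //; rewrite lerBrDr.
by apply: subdif_shift2_gt0; [exact: above_le pr|exact: cond_le pr cp].
Qed.

Lemma barrier_subdif p j : above f p -> cond p -> j != z -> j != w ->
  dif (subdif c z w f) j (shift2 z w p x) * f p <=
  dif f j p * subdif c z w f (shift2 z w p x).
Proof.
move=> af cp jz jw.
have mj := multiaffine_dif j mf.
have -> : dif (subdif c z w f) j (shift2 z w p x) = subdif c z w (dif f j) (shift2 z w p x).
  exact: dif_subdif.
rewrite !subdif_shift2 //.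
have fp : 0 < f p by exact: af.
apply: wronskian_combination => //.
- by move=> t; apply: wronskian_ge0.
- by rewrite addr_ge0 // (above_dif _ mf af).
- by rewrite addr_ge0 // (above_dif2 _ _ mf af).
(* If f_z + f_w = 0, both terms vanish and Rayleigh leaves f f_zw <= 0. *)
- have z0 : 0 <= dif f z p by exact: above_dif mf af _.
  have w0 : 0 <= dif f w p by exact: above_dif mf af _.
  have zw0 : 0 <= dif (dif f z) w p by exact: above_dif2 mf af _.
  have := rf p zw => + b0; have -> : dif f z p = 0 by lra.
  by rewrite mul0r pmulr_rle0 // => ?; apply/eqP; rewrite eq_le zw0 andbT.
- exact: above_dif2 mf af _.
Qed.

End Step.

(** * Undoing one operator by choosing an atom *)

Section Greedy.
Variables (f : (I -> R) -> R) (z w : I) (c : R) (p : I -> R).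
Hypotheses (mf : multiaffine f) (rf : rayleigh f) (zw : z != w).
Hypotheses (c0 : 0 <= c).
Let g := subdif c z w f.
Let mg : multiaffine g. Proof. exact: multiaffine_subdif. Qed.
Let pt q e := upd (upd q z (q z + e)) w (q w - e).

Let pt_taylor q e : f (pt q e) = f q + e * (dif f z q - dif f w q) - e ^+ 2 * dif (dif f z) w q.
Proof.
rewrite /pt; have -> : q w = upd q z (q z + e) w by rewrite upd_other // eq_sym.
rewrite taylor // taylor //.
rewrite -[dif f w _]/((dif f w) (upd q z (q z + e))) taylor; last exact: multiaffine_dif.
by rewrite (difC f w z); ring.
Qed.

(** The correction term c f_zw does not depend on z or w, so sign information on these derivatives
    passes from [g] to [f]. *)
Let dif_z_g q : dif g z q = dif f z q.
Proof. by rewrite /g dif_subdif (dif_rot f z w z) dif_rot dif_dif mulr0 subr0. Qed.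

Let dif_w_g q : dif g w q = dif f w q.
Proof. by rewrite /g dif_subdif dif_rot dif_dif mulr0 subr0. Qed.

Let subdif_zw q : dif (dif g z) w q = dif (dif f z) w q.
Proof. by rewrite (_ : dif g z = dif f z) //; apply: funext => r; exact: dif_z_g. Qed.

Let dif_z_pt q e : dif f z (pt q e) = dif f z q - e * dif (dif f z) w q.
Proof.
by rewrite /pt updC // dif_upd taylor ?mulNr //; exact: multiaffine_dif.
Qed.

Let dif_w_pt q e : dif f w (pt q e) = dif f w q + e * dif (dif f z) w q.
Proof.
by rewrite /pt dif_upd taylor ?(difC f w z) //; exact: multiaffine_dif.
Qed.

Let dif2_pt q e : dif (dif f z) w (pt q e) = dif (dif f z) w q.
Proof. by rewrite /pt dif_upd difC dif_upd difC. Qed.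

(** The antidiagonal move keeps f_z + f_w, which is nonnegative at [q]. If f_zw > 0, Rayleigh makes
    the product f_z f_w positive, so both factors are positive. *)
Let pt_grad q e : above g q -> 0 < f (pt q e) ->
  0 <= dif f z (pt q e) /\ 0 <= dif f w (pt q e).
Proof.
move=> ag fq.
have z0 : 0 <= dif f z q by rewrite -dif_z_g; exact: above_dif mg ag _.
have w0 : 0 <= dif f w q by rewrite -dif_w_g; exact: above_dif mg ag _.
have k0 : 0 <= dif (dif f z) w q by rewrite -subdif_zw; exact: above_dif2 mg ag _.
have := rf (pt q e) zw; rewrite dif2_pt.
have [kz|kn0] := eqVneq (dif (dif f z) w q) 0.
  by rewrite dif_z_pt dif_w_pt kz !mulr0 subr0 addr0.
move=> h; have {h} : 0 < dif f z (pt q e) * dif f w (pt q e).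
  by apply: lt_le_trans h; rewrite mulr_gt0 // lt_neqAle eq_sym kn0.
have : 0 <= dif f z (pt q e) + dif f w (pt q e).
  by rewrite dif_z_pt dif_w_pt; lra.
move: (dif f z (pt q e)) (dif f w (pt q e)) => a b; nra.
Qed.

(* The ratio dif f j / f decreases from pt q e to its translate by |e| in z and w, which is
   above q, where dif f j is nonnegative. *)
Let pt_dif_ge0 q e j : above g q -> 0 < f (pt q e) -> j != z -> j != w ->
  0 <= dif f j (pt q e).
Proof.
move=> ag fq jz jw.
have [z0 w0] := pt_grad ag fq.
have k0 : 0 <= dif (dif f z) w (pt q e).
  by rewrite dif2_pt -subdif_zw; exact: above_dif2 mg ag _.
have e0 : 0 <= `|e| by exact: normr_ge0.
set u := pt q e in fq z0 w0 k0 *.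
have step (h : I) (v : I -> R) : j != h -> 
    dif f j (upd v h (v h + `|e|)) * f v <= dif f j v * f (upd v h (v h + `|e|)).
  move=> jh; rewrite !taylor //; last exact: multiaffine_dif.
  have := ler_wpM2l e0 (rf v jh); lra.
set u1 := upd u z (u z + `|e|).
set u2 := upd u1 w (u1 w + `|e|).
have f1 : 0 < f u1 by rewrite /u1 taylor // ltr_wpDr // mulr_ge0.
have qu k : q k <= u2 k.
  have := ler_norm e; have := ler_norm (- e); rewrite normrN => eN eP.
  rewrite /u2 /u1 /u /pt; have [->|kw] := eqVneq k w.
    rewrite upd_same upd_other 1?eq_sym // upd_same; lra.
  rewrite upd_other //; have [->|kz] := eqVneq k z; last by rewrite !upd_other.
  rewrite upd_same upd_other // upd_same; lra.
have g3 : 0 <= dif (dif (dif f j) z) w u2.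
  have E : dif (dif f z) w = dif (dif g z) w.
    by apply: funext => v; rewrite subdif_zw.
  by rewrite dif_rot E; exact: above_dif3 mg ag qu.
have fj2 : 0 <= dif f j u2.
  have := above_dif j mg ag qu; rewrite /g dif_subdif subr_ge0.
  by apply: le_trans; rewrite mulr_ge0.
have f2 : 0 < f u2.
  have := ag _ qu; rewrite /g /subdif subr_gt0; apply: le_lt_trans.
  by rewrite mulr_ge0 // -subdif_zw; exact: above_dif2 mg ag _.
have j1 : 0 <= dif f j u1.
  have h : 0 <= dif f j u2 * f u1 by rewrite mulr_ge0 // ltW.
  by have := le_trans h (step w u1 jw); rewrite pmulr_lge0.
have h : 0 <= dif f j u1 * f u by rewrite mulr_ge0 // ltW.
by have := le_trans h (step z u jz); rewrite pmulr_lge0.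
Qed.

Lemma above_of_above_subdif e : above (subdif c z w f) p -> 
  0 < f (upd (upd p z (p z + e)) w (p w - e)) ->
  above f (upd (upd p z (p z + e)) w (p w - e)).
Proof.
move=> ag fp r pr.
(* The target [r] is reached in two stages: first the coordinates other than z, w are raised with
   [e] fixed, then z and w are raised. *)
pose q := upd (upd r z (p z)) w (p w).
have qz : q z = p z by rewrite /q upd_other // upd_same.
have qw : q w = p w by rewrite /q upd_same.
have pq k : p k <= q k.
  rewrite /q /upd; case: eqP => [->|/eqP kw] //; case: eqP => [->|/eqP kz] //.
  by have := pr k; rewrite !upd_other.
have agq : above g q by exact: above_le pq.
have fq : 0 < f (pt q e).
  apply: (@upd_ind _ _ (fun u => 0 < f (pt u e)) p q) => // u i ub ui fu.
  have pu k : p k <= u k by case: (ub k) => ->.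
  have [iz|iz] := eqVneq i z; first by rewrite {2}iz qz -iz -ui upd_id.
  have [iw|iw] := eqVneq i w; first by rewrite {2}iw qw -iw -ui upd_id.
  have -> : pt (upd u i (q i)) e = upd (pt u e) i (pt u e i + (q i - u i)).
    apply: funext => k; rewrite /pt /upd (negbTE iz) (negbTE iw).
    rewrite [z == i]eq_sym [w == i]eq_sym (negbTE iz) (negbTE iw).
    have [->|kw] := eqVneq k w; first by rewrite eq_sym (negbTE iw).
    have [->|kz] := eqVneq k z; first by rewrite eq_sym (negbTE iz).
    by case: eqP => // _; rewrite addrC subrK.
  rewrite taylor // ltr_wpDr // mulr_ge0 //; first by rewrite subr_ge0 ui.
  by apply: pt_dif_ge0 => //; exact: above_le pu.
have [z0 w0] := pt_grad agq fq.
have k0 : 0 <= dif (dif f z) w q.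
  by rewrite -subdif_zw; exact: above_dif2 mg agq _.
pose x := r z - (p z + e); pose y := r w - (p w - e).
have x0 : 0 <= x.
  by have := pr z; rewrite upd_other // upd_same subr_ge0.
have y0 : 0 <= y by have := pr w; rewrite upd_same subr_ge0.
have -> : r = upd (upd (pt q e) z (pt q e z + x)) w (upd (pt q e) z (pt q e z + x) w + y).
  apply: funext => k; rewrite /pt /upd !eqxx (negbTE zw) [w == z]eq_sym (negbTE zw) /q /upd.
  rewrite !eqxx (negbTE zw) /x /y.
  by case: eqP => [->|_]; [ring|case: eqP => [->|_] //; ring].
rewrite !taylor //; last exact: multiaffine_dif.
rewrite (difC f w z) dif2_pt.
have a1 := mulr_ge0 x0 z0; have a2 := mulr_ge0 y0 w0.
have a3 := mulr_ge0 y0 (mulr_ge0 x0 k0); lra.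
Qed.

Lemma greedy_value e : f (upd (upd p z (p z + e)) w (p w - e)) =
  f p + e * (dif f z p - dif f w p) - e ^+ 2 * dif (dif f z) w p.
Proof. exact: pt_taylor. Qed.

End Greedy.
End Barrier.

Section GreedyRV.
Context {R : realType} {I : finType}.

Lemma fvar_ge0 (X : finRV R) : 0 <= fvar X.
Proof.
rewrite /fvar big_seq sumr_ge0 // => x xX.
by rewrite mulr_ge0 ?sqr_ge0 // ltW // fprob_pos.
Qed.

Lemma centered_sum (X : finRV R) :
  \sum_(x <- fsupp X) fprob X x * (x - fexp X) = 0.
Proof.
under eq_bigr do rewrite mulrBr.
by rewrite sumrB -mulr_suml fprob_sum1 mul1r subrr.
Qed.

Lemma greedy_step (f : (I -> R) -> R) (z w : I) (p : I -> R) (X : finRV R) :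
  multiaffine f -> rayleigh f -> z != w -> above (subdif (fvar X) z w f) p ->
  exists2 e, e \in fsupp X &
    above f (upd (upd p z (p z + (e - fexp X))) w (p w - (e - fexp X))).
Proof.
move=> mf rf zw ag.
have c0 := fvar_ge0 X.
pose h e := f (upd (upd p z (p z + (e - fexp X))) w (p w - (e - fexp X))).
(* Averaging the second-order expansion over the atoms kills the linear term and turns e^2 into the
   variance. *)
have gE : subdif (fvar X) z w f p = \sum_(e <- fsupp X) fprob X e * h e.
  have hE e : fprob X e * h e = fprob X e * f p
      + fprob X e * (e - fexp X) * (dif f z p - dif f w p)
      - fprob X e * (e - fexp X) ^+ 2 * dif (dif f z) w p.
    by rewrite /h greedy_value //; ring.
  under eq_bigr do rewrite hE.
  by rewrite sumrB big_split /= -!mulr_suml fprob_sum1 centered_sum mul0r addr0 mul1r.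
have gp : 0 < subdif (fvar X) z w f p by exact: ag.
have [/hasP[e eX he]|/hasPn nh] := boolP (has (fun e => 0 < h e) (fsupp X)).
  by exists e => //; exact: (above_of_above_subdif (c := fvar X)).
suff : subdif (fvar X) z w f p <= 0 by rewrite leNgt gp.
rewrite gE big_seq sumr_le0 // => e eX; apply: mulr_ge0_le0.
  exact/ltW/fprob_pos.
by have := nh _ eX; rewrite -leNgt.
Qed.

End GreedyRV.

(** * Stability in the upper half plane *)

Section Stability.
Context {R : rcfType} {I : finType}.
Implicit Types (F : (I -> R[i]) -> R[i]) (v : I -> R[i]) (p : I -> R) (i j : I).

(** For y != 0 this has the sign of Im (x / y), but it is polynomial and defined at y = 0. *)
Definition imJ (x y : R[i]) : R := complex.Im (x * conjc y).

Definition toC p : I -> R[i] := fun k => (p k)%:C.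

Definition realpart F p : R := complex.Re (F (toC p)).

Record stable F : Prop := Stable {
  stable_multiaffine : multiaffine F;
  stable_real : forall p, complex.Im (F (toC p)) = 0;
  stable_neq0 : forall v, (forall k, 0 < complex.Im (v k)) -> F v != 0 }.

Lemma imJDi (x y b d : R[i]) (e : R) :
  imJ (x + (0 +i* e) * b) (y + (0 +i* e) * d) =
  imJ x y + (complex.Re (b * conjc y) - complex.Re (x * conjc d)) * e + imJ b d * e ^+ 2.
Proof.
case: x y b d => [x1 x2] [y1 y2] [b1 b2] [d1 d2]; rewrite /imJ; simpc => /=; ring.
Qed.

Lemma imJDr (x y b d : R[i]) (e : R) :
  imJ (x + e%:C * b) (y + e%:C * d) =
  imJ x y + (imJ b y + imJ x d) * e + imJ b d * e ^+ 2.
Proof.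
case: x y b d => [x1 x2] [y1 y2] [b1 b2] [d1 d2]; rewrite /imJ; simpc => /=; ring.
Qed.

Lemma imJDl (a b z : R[i]) : imJ (a + z * b) b = imJ a b + complex.Im z * complex.Re (b * conjc b).
Proof. by case: a b z => [? ?] [? ?] [? ?]; rewrite /imJ; simpc => /=; ring. Qed.

Lemma imJN (a b : R[i]) : imJ b a = - imJ a b.
Proof. by case: a b => [? ?] [? ?]; rewrite /imJ; simpc => /=; ring. Qed.

Lemma normJ_gt0 (b : R[i]) : b != 0 -> 0 < complex.Re (b * conjc b).
Proof.
case: b => b1 b2; rewrite eq_complex /= negb_and; simpc => /= h.
have b1_ge0 := sqr_ge0 b1; have b2_ge0 := sqr_ge0 b2.
case/orP: h => h.
  have : 0 < b1 ^+ 2 by rewrite exprn_even_gt0.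
  lra.
have : 0 < b2 ^+ 2 by rewrite exprn_even_gt0.
lra.
Qed.

Lemma upper_root (a b : R[i]) : imJ a b < 0 ->
  exists2 z, 0 < complex.Im z & a + z * b = 0.
Proof.
move=> ab; have b0 : b != 0.
  by apply: contraTneq ab => ->; rewrite /imJ conjc0 mulr0 ltxx.
exists (- (a / b)); last by rewrite mulNr divfK // subrr.
have n0 := normJ_gt0 b0; set n := complex.Re _ in n0.
have -> : a / b = a * conjc b * (n^-1)%:C.
  apply: (mulIf b0); rewrite divfK // -mulrA -mulrA [conjc b * _]mulrC -mulrA.
  rewrite [_ * b]mulrC.
  have -> : b * conjc b = n%:C by rewrite /n; case: (b) => ? ?; simpc => /=; congr (_ +i* _); ring.
  by rewrite -rmorphM mulVf ?gt_eqF // mulr1.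
have -> : complex.Im (- (a * conjc b * (n^-1)%:C)) = - imJ a b / n.
  by rewrite /imJ; case: (a * _) => ? ?; simpc => /=; ring.
by rewrite divr_gt0 // oppr_gt0.
Qed.

(** In coordinate [i] the function is a + z b; a negative [imJ a b] would put its root -a / b in the
    upper half plane. *)
Lemma stable_imJ_open F v i : stable F -> (forall k, 0 < complex.Im (v k)) ->
  0 <= imJ (F v) (dif F i v).
Proof.
move=> sF vp; have mF := stable_multiaffine sF.
rewrite -[in F v](upd_id v i) mF imJDl addr_ge0 //; last first.
  apply: mulr_ge0; first exact: ltW.
  by case: (dif F i v) => ? ?; simpc => /=; nra.
rewrite leNgt; apply/negP => /upper_root[z z0].
rewrite -mF => /eqP; apply/negP; apply: (stable_neq0 sF) => k.
by rewrite /upd; case: eqP.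
Qed.

(** Passes to the closed half plane: the list [s] holds the coordinates that may be real, and each
    is raised by a small imaginary amount that then tends to 0. *)
Lemma stable_imJ F v i : stable F -> (forall k, 0 <= complex.Im (v k)) ->
  0 <= imJ (F v) (dif F i v).
Proof.
move=> sF v0; have mF := stable_multiaffine sF.
suff h (s : seq I) u : (forall k, 0 <= complex.Im (u k)) ->
    (forall k, k \notin s -> 0 < complex.Im (u k)) -> 0 <= imJ (F u) (dif F i u).
  by apply: (h (enum I)) => // k; rewrite mem_enum.
elim: s u => [u _ up|j s IH u u0 up].
  by apply: stable_imJ_open => // k; exact: up.
apply: (@quadratic_const_ge0 _ _
  (complex.Re (dif F j u * conjc (dif F i u)) - complex.Re (F u * conjc (dif (dif F i) j u)))
  (imJ (dif F j u) (dif (dif F i) j u))) => e e0.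
rewrite -imJDi -!taylor //; last exact: multiaffine_dif.
apply: IH => k; rewrite /upd; case: eqP => [_|/eqP kj].
- have := u0 j; case: (u j) => ? ? /=; simpc => /= ?. lra.
- by [].
- by move=> _; have := u0 j; case: (u j) => ? ? /=; simpc => /= ?; lra.
- by move=> ks; apply: up; rewrite inE negb_or kj.
Qed.

(** Coordinate [i] is moved by a real e in the inequality of [stable_imJ] for [j]; the claim is the
    leading coefficient in e. *)
Lemma stable_imJ_dif F v i j : stable F -> (forall k, 0 <= complex.Im (v k)) ->
  0 <= imJ (dif F i v) (dif (dif F i) j v).
Proof.
move=> sF v0; have mF := stable_multiaffine sF.
have [->|ij] := eqVneq i j.
  by rewrite dif_dif /imJ conjc0 mulr0.
apply: (@quadratic_lead_ge0 _ (imJ (F v) (dif F j v))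
   (imJ (dif F i v) (dif F j v) + imJ (F v) (dif (dif F j) i v))) => e _.
rewrite (difC F i j) -imJDr -!taylor //; last exact: multiaffine_dif.
apply: stable_imJ => // k; rewrite /upd; case: eqP => [_|//].
by have := v0 i; case: (v i) => ? ? /=; simpc.
Qed.

Lemma upd_toC p i x : upd (toC p) i x%:C = toC (upd p i x).
Proof. by apply: funext => k; rewrite /toC /upd; case: eqP. Qed.

Lemma dif_toC F p i : dif F i (toC p) = F (toC (upd p i 1)) - F (toC (upd p i 0)).
Proof. by rewrite /dif -!upd_toC. Qed.

Lemma dif_real F i : (forall p, complex.Im (F (toC p)) = 0) ->
  forall p, complex.Im (dif F i (toC p)) = 0.
Proof. by move=> rF p; rewrite dif_toC raddfB /= !rF subrr. Qed.

Lemma dif_realpart F i : dif (realpart F) i = realpart (dif F i).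
Proof. by apply: funext => p; rewrite /realpart dif_toC raddfB. Qed.

Lemma Re_mulC (x : R) (y : R[i]) : complex.Re (x%:C * y) = x * complex.Re y.
Proof. by case: y => ? ?; simpc => /=; ring. Qed.

Lemma Im_mulC (x : R) (y : R[i]) : complex.Im (x%:C * y) = x * complex.Im y.
Proof. by case: y => ? ?; simpc => /=; ring. Qed.

Lemma multiaffine_realpart F : multiaffine F -> multiaffine (realpart F).
Proof.
move=> mF p i x; rewrite dif_realpart /realpart -!upd_toC (mF _ i x%:C) raddfD /= Re_mulC.
by [].
Qed.

Lemma realpart_subdif F c i j :
  realpart (subdif c%:C i j F) = subdif c i j (realpart F).
Proof.
apply: funext => p; rewrite /subdif !dif_realpart /realpart raddfB /= Re_mulC.
by [].
Qed.

Lemma rayleigh_realpart F : stable F -> rayleigh (realpart F).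
Proof.
move=> sF p i j ij; have mF := stable_multiaffine sF.
have rF := stable_real sF; have rFi := dif_real i rF.
(* At the point p with the imaginary unit added in coordinate [j], [imJ] equals F_i F_j - F F_ij. *)
have h : 0 <= imJ (F (upd (toC p) j (toC p j + (0 +i* 1))))
                  (dif F i (upd (toC p) j (toC p j + (0 +i* 1)))).
  apply: stable_imJ => // k; rewrite /upd; case: eqP => [_|_] /=; simpc => //=; rewrite ?ler01.
move: h; rewrite !taylor //; last exact: multiaffine_dif.
rewrite !dif_realpart /realpart.
have := rF p; have := rFi p; have := dif_real j rF p; have := dif_real j rFi p.
case: (F _) => ? ? /=; case: (dif F i _) => ? ? /=; case: (dif F j _) => ? ? /=.
case: (dif _ _ _) => ? ? /= -> -> -> ->; rewrite /imJ; simpc => /=; lra.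
Qed.

(** At a zero, F = c K with K = F_ij. Then Im (F conj F_i) > 0 strictly, whereas Im (c K conj F_i) =
    - c Im (F_i conj K) <= 0. *)
Lemma stable_subdif F (c : R) i j : stable F -> 0 <= c -> i != j ->
  stable (subdif c%:C i j F).
Proof.
move=> sF c0 ij; have mF := stable_multiaffine sF; have rF := stable_real sF.
split; first exact: multiaffine_subdif.
- move=> p; rewrite /subdif raddfB /= Im_mulC rF !(dif_real, mulr0, subr0) //.
  by move=> q; exact: dif_real.
move=> v vp; rewrite /subdif subr_eq0; apply/negP => /eqP FK.
have vge k : 0 <= complex.Im (v k) by exact: ltW.
set K := dif (dif F i) j v in FK.
have [K0|Kn0] := eqVneq K 0.
  by have := stable_neq0 sF vp; rewrite FK K0 mulr0 eqxx.
have Fi0 : dif F i v != 0.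
  apply/negP => /eqP Fi0.
  have u0 k : 0 <= complex.Im (upd v j 0 k) by rewrite /upd; case: eqP.
  have := stable_imJ_dif i j sF u0; rewrite dif_upd -/K => h.
  have : imJ (dif F i v) K = 0 by rewrite Fi0 /imJ mul0r.
  rewrite -[in dif F i v](upd_id v j) (multiaffine_dif i mF) -/K imJDl.
  have := mulr_gt0 (vp j) (normJ_gt0 Kn0); lra.
have h1 : 0 < imJ (F v) (dif F i v).
  have u0 k : 0 <= complex.Im (upd v i 0 k) by rewrite /upd; case: eqP.
  have := stable_imJ i sF u0; rewrite dif_upd => h.
  rewrite -[in F v](upd_id v i) mF imJDl.
  by have := mulr_gt0 (vp i) (normJ_gt0 Fi0); lra.
have h2 := stable_imJ_dif i j sF vge.
move: h1; rewrite FK.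
have -> : imJ (c%:C * K) (dif F i v) = - (c * imJ (dif F i v) K).
  by rewrite (imJN K (dif F i v)) mulrN opprK /imJ -mulrA Im_mulC.
by rewrite oppr_gt0 ltNge mulr_ge0.
Qed.

End Stability.

(** * Hermitian forms and the operator norm *)

Section Vectors.
Context {R : realType}.

Definition dot d (x y : 'cV[R[i]]_d) : R[i] := (adjmx x *m y) 0 0.

Definition rdot d (x y : 'cV[R[i]]_d) : R := complex.Re (dot x y).

Lemma dotE d (x y : 'cV[R[i]]_d) : dot x y = \sum_k conjc (x k 0) * y k 0.
Proof. by rewrite /dot mxE; apply: eq_bigr => k _; rewrite !mxE. Qed.

Lemma dotJ d (x y : 'cV[R[i]]_d) : dot y x = conjc (dot x y).
Proof.
rewrite !dotE rmorph_sum; apply: eq_bigr => k _.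
by rewrite rmorphM /= conjcK mulrC.
Qed.

Lemma dotDr d (x y z : 'cV[R[i]]_d) : dot x (y + z) = dot x y + dot x z.
Proof. by rewrite /dot mulmxDr mxE. Qed.

Lemma dotZr d (x y : 'cV[R[i]]_d) a : dot x (a *: y) = a * dot x y.
Proof. by rewrite /dot -scalemxAr mxE. Qed.

Lemma dotDl d (x y z : 'cV[R[i]]_d) : dot (y + z) x = dot y x + dot z x.
Proof. by rewrite dotJ dotDr rmorphD /= -!dotJ. Qed.

Lemma dotZl d (x y : 'cV[R[i]]_d) a : dot (a *: y) x = conjc a * dot y x.
Proof. by rewrite dotJ dotZr rmorphM /= -dotJ. Qed.

Lemma dot_vnorm2 d (x : 'cV[R[i]]_d) : dot x x = (vnorm2 x)%:C.
Proof.
rewrite dotE /vnorm2 rmorph_sum; apply: eq_bigr => k _ /=.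
by case: (x k 0) => a b; simpc => /=; congr (_ +i* _); ring.
Qed.

Lemma vnorm2_ge0 d (x : 'cV[R[i]]_d) : 0 <= vnorm2 x.
Proof. by apply: sumr_ge0 => k _; rewrite addr_ge0 ?sqr_ge0. Qed.

Lemma vnorm2_eq0 d (x : 'cV[R[i]]_d) : vnorm2 x = 0 -> x = 0.
Proof.
move=> /eqP; rewrite psumr_eq0 => [/allP h|k _]; last by rewrite addr_ge0 ?sqr_ge0.
apply/matrixP => k j; rewrite (ord1 j) mxE.
have := h k (mem_index_enum k); rewrite /= paddr_eq0 ?sqr_ge0 // !sqrf_eq0.
by case/andP=> /eqP r0 /eqP i0; apply/eqP; rewrite eq_complex r0 i0 !eqxx.
Qed.

Lemma vnorm2_gt0 d (x : 'cV[R[i]]_d) : x != 0 -> 0 < vnorm2 x.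
Proof.
move=> x0; rewrite lt_neqAle vnorm2_ge0 andbT eq_sym.
by apply: contra x0 => /eqP/vnorm2_eq0 ->.
Qed.

Lemma vnorm20 d : vnorm2 (0 : 'cV[R[i]]_d) = 0.
Proof. by rewrite /vnorm2 big1 // => k _; rewrite !mxE /= expr0n addr0. Qed.

Lemma rdotC d (x y : 'cV[R[i]]_d) : rdot x y = rdot y x.
Proof. by rewrite /rdot dotJ; case: (dot y x). Qed.

Lemma rdotDr d (x y z : 'cV[R[i]]_d) : rdot x (y + z) = rdot x y + rdot x z.
Proof. by rewrite /rdot dotDr raddfD. Qed.

Lemma rdotZr d (x y : 'cV[R[i]]_d) a : rdot x (a%:C *: y) = a * rdot x y.
Proof. by rewrite /rdot dotZr Re_mulC. Qed.

Lemma rdotDl d (x y z : 'cV[R[i]]_d) : rdot (y + z) x = rdot y x + rdot z x.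
Proof. by rewrite rdotC rdotDr !(rdotC x). Qed.

Lemma rdotZl d (x y : 'cV[R[i]]_d) a : rdot (a%:C *: y) x = a * rdot y x.
Proof. by rewrite rdotC rdotZr rdotC. Qed.

Lemma rdotxx d (x : 'cV[R[i]]_d) : rdot x x = vnorm2 x.
Proof. by rewrite /rdot dot_vnorm2. Qed.

Definition dot2 d (x y : 'cV[R[i]]_d) : R := complex.Re (dot x y * conjc (dot x y)).

Lemma mulJ_real (a : R[i]) : a * conjc a = (complex.Re (a * conjc a))%:C.
Proof. by case: a => ? ?; simpc => /=; congr (_ +i* _); ring. Qed.

Lemma dot2_ge0 d (x y : 'cV[R[i]]_d) : 0 <= dot2 x y.
Proof. by rewrite /dot2; case: (dot x y) => a b; simpc => /=; nra. Qed.

Lemma dot2xx d (x : 'cV[R[i]]_d) : dot2 x x = vnorm2 x ^+ 2.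
Proof. by rewrite /dot2 dot_vnorm2; simpc => /=; ring. Qed.

Lemma adjmxM m n p (A : 'M[R[i]]_(m, n)) (B : 'M_(n, p)) :
  adjmx (A *m B) = adjmx B *m adjmx A.
Proof. by rewrite /adjmx map_mxM trmx_mul. Qed.

Lemma adjmxK m n (A : 'M[R[i]]_(m, n)) : adjmx (adjmx A) = A.
Proof. by apply/matrixP => i j; rewrite !mxE conjcK. Qed.

Lemma dot_mulmx d (A : 'M[R[i]]_d) x y : dot x (A *m y) = dot (adjmx A *m x) y.
Proof. by rewrite /dot adjmxM adjmxK mulmxA. Qed.

Lemma rdot_vnorm2D d (x y : 'cV[R[i]]_d) :
  vnorm2 (x + y) = vnorm2 x + 2 * rdot x y + vnorm2 y.
Proof. by rewrite -!rdotxx !(rdotDl, rdotDr) (rdotC y x); ring. Qed.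

Lemma herm_dot_real d (N : 'M[R[i]]_d) x : adjmx N = N ->
  dot x (N *m x) = (rdot x (N *m x))%:C.
Proof.
move=> aN.
have h : dot x (N *m x) = conjc (dot x (N *m x)) by rewrite -dotJ dot_mulmx aN.
by rewrite /rdot; case: (dot _ _) h => a b [h]; congr (_ +i* _); lra.
Qed.

(* The form of [N] is nonnegative at x - (t / c) y. *)
Lemma cauchy_schwarz d (N : 'M[R[i]]_d) x y : adjmx N = N ->
    (forall z, 0 <= rdot z (N *m z)) -> 0 < rdot y (N *m y) ->
  complex.Re (dot y (N *m x) * conjc (dot y (N *m x))) <=
    rdot y (N *m y) * rdot x (N *m x).
Proof.
move=> aN N0 c0; set t := dot y (N *m x).
have := N0 (x + (- (t * ((rdot y (N *m y))^-1)%:C)) *: y).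
have txy : dot x (N *m y) = conjc t by rewrite dot_mulmx aN dotJ.
set c := rdot y (N *m y) in c0 *.
have cE : dot y (N *m y) = c%:C.
  exact: herm_dot_real.
rewrite /rdot mulmxDr -scalemxAr !(dotDl, dotDr, dotZl, dotZr) txy cE -/t.
move: (dot x (N *m x)) => X.
set W := (X in 0 <= complex.Re X).
have -> : complex.Re W = complex.Re X - complex.Re (t * conjc t) / c.
  rewrite /W; case: X {W} => a b; case: (t) => t1 t2; simpc => /=; field; exact: lt0r_neq0 c0.
by rewrite subr_ge0 ler_pdivrMr // [c * _]mulrC.
Qed.

Lemma dot2_le d (x y : 'cV[R[i]]_d) : dot2 x y <= vnorm2 x * vnorm2 y.
Proof.
have [->|x0] := eqVneq x 0.
  by rewrite vnorm20 mul0r /dot2 dotJ /dot mulmx0 mxE !conjc0 mulr0.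
have a1 : adjmx (1%:M : 'M[R[i]]_d) = 1%:M by rewrite /adjmx map_mx1 trmx1.
have := @cauchy_schwarz d 1%:M y x a1; rewrite !mul1mx !rdotxx; apply.
  by move=> z; rewrite mul1mx rdotxx vnorm2_ge0.
exact: vnorm2_gt0.
Qed.

Lemma rk1_mul d (u x : 'cV[R[i]]_d) : rk1 u *m x = dot u x *: u.
Proof.
rewrite /rk1 -mulmxA [adjmx u *m x]mx11_scalar mul_mx_scalar.
by congr (_ *: _); rewrite /dot.
Qed.

Lemma dot_rk1 d (u x : 'cV[R[i]]_d) : dot x (rk1 u *m x) = (dot2 u x)%:C.
Proof. by rewrite rk1_mul dotZr [dot x u]dotJ mulJ_real. Qed.

Lemma adjmx_rk1 d (u : 'cV[R[i]]_d) : adjmx (rk1 u) = rk1 u.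
Proof. by rewrite /rk1 adjmxM adjmxK. Qed.

Lemma opnorm_le m n (A : 'M[R[i]]_(m, n)) (B : R) : 0 <= B ->
  (forall x, vnorm2 (A *m x) <= B ^+ 2 * vnorm2 x) -> opnorm A <= B.
Proof.
move=> B0 h; apply: ge_sup.
  by exists (Num.sqrt (vnorm2 (A *m 0))); exists 0 => //=; rewrite vnorm20 ler01.
move=> _ [x /= x1 <-]; rewrite -(ger0_norm B0) -sqrtr_sqr; apply: ler_wsqrtr.
by apply: le_trans (h x) _; rewrite ler_piMr ?sqr_ge0.
Qed.

(** A Frobenius bound, which shows that the set in [opnorm] is bounded, so that its supremum is
    meaningful. *)
Lemma vnorm2_mulmx_bound m n (A : 'M[R[i]]_(m, n)) (x : 'cV_n) :
  vnorm2 (A *m x) <= (\sum_k vnorm2 (adjmx (row k A))) * vnorm2 x.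
Proof.
rewrite mulr_suml; apply: ler_sum => k _.
apply: le_trans (dot2_le _ _); rewrite /dot2 /dot adjmxK -row_mul.
by rewrite [row k _ 0 0]mxE; case: ((A *m x) k 0) => a b; simpc => /=; nra.
Qed.

Lemma vnorm2Z d (x : 'cV[R[i]]_d) (a : R) : vnorm2 (a%:C *: x) = a ^+ 2 * vnorm2 x.
Proof. by rewrite -!rdotxx rdotZl rdotZr mulrA. Qed.

Lemma opnorm_ub m n (A : 'M[R[i]]_(m, n)) (x : 'cV_n) :
  vnorm2 x <= 1 -> Num.sqrt (vnorm2 (A *m x)) <= opnorm A.
Proof.
move=> x1; apply: ub_le_sup; last by exists x.
exists (Num.sqrt (\sum_k vnorm2 (adjmx (row k A)))) => _ [y /= y1 <-].
apply: ler_wsqrtr; apply: le_trans (vnorm2_mulmx_bound _ _) _.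
by rewrite ler_piMr // sumr_ge0 // => k _; exact: vnorm2_ge0.
Qed.

Lemma opnorm_ge0 m n (A : 'M[R[i]]_(m, n)) : 0 <= opnorm A.
Proof.
by apply: le_trans (opnorm_ub A (x := 0) _); rewrite ?sqrtr_ge0 // vnorm20 ler01.
Qed.

Lemma vnorm2_mulmx_le m n (A : 'M[R[i]]_(m, n)) (x : 'cV_n) :
  vnorm2 (A *m x) <= opnorm A ^+ 2 * vnorm2 x.
Proof.
have [->|x0] := eqVneq x 0; first by rewrite mulmx0 !vnorm20 mulr0.
have n0 := vnorm2_gt0 x0.
have s0 : 0 < Num.sqrt (vnorm2 x) by rewrite sqrtr_gt0.
have x'1 : vnorm2 ((Num.sqrt (vnorm2 x))^-1%:C *: x) = 1.
  by rewrite vnorm2Z exprVn sqr_sqrtr ?vnorm2_ge0 // mulVf // gt_eqF.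
have := opnorm_ub A (x := (Num.sqrt (vnorm2 x))^-1%:C *: x).
rewrite x'1 lexx => /(_ isT).
rewrite -scalemxAr vnorm2Z exprVn sqr_sqrtr ?vnorm2_ge0 //.
rewrite -(ler_pXn2r (n := 2)) ?nnegrE ?sqrtr_ge0 ?opnorm_ge0 //.
rewrite sqr_sqrtr; last by rewrite mulr_ge0 ?invr_ge0 ?vnorm2_ge0.
by rewrite mulrC ler_pdivrMr.
Qed.

Lemma rdot_mulmx_le d (A : 'M[R[i]]_d) (x : 'cV_d) :
  rdot x (A *m x) <= opnorm A * vnorm2 x.
Proof.
have h := vnorm2_mulmx_le A x; have a0 := opnorm_ge0 A.
have [a00|an0] := eqVneq (opnorm A) 0.
  rewrite a00 expr0n mul0r in h *.
  have -> : A *m x = 0 by apply: vnorm2_eq0; apply/eqP; rewrite eq_le h vnorm2_ge0.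
  by rewrite /rdot /dot mulmx0 mxE.
have a1 : 0 < opnorm A by rewrite lt_neqAle eq_sym an0.
(* Expanding this square bounds 2 |A| Re (x^* A x) by 2 |A|^2 |x|^2. *)
have := vnorm2_ge0 (A *m x + (- opnorm A)%:C *: x).
rewrite rdot_vnorm2D vnorm2Z rdotZr (rdotC (A *m x)) => h2.
rewrite -(ler_pM2l a1); nra.
Qed.

(* With y = H x, apply the form bounds to a x + y and a x - y: this is the identity
   2 a (a^2 - H^2) = (a + H) (a - H) (a + H) + (a - H) (a + H) (a - H). *)
Lemma opnorm_herm_le d (H : 'M[R[i]]_d) (a : R) : 0 < a -> adjmx H = H ->
    (forall x, rdot x (H *m x) <= a * vnorm2 x) ->
    (forall x, - (a * vnorm2 x) <= rdot x (H *m x)) ->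
  opnorm H <= a.
Proof.
move=> a0 aH hu hl; apply: opnorm_le => [|x]; first exact: ltW.
set y := H *m x.
have hh z t : rdot z (H *m t) = rdot (H *m z) t by rewrite /rdot dot_mulmx aH.
have := hu (a%:C *: x + y); have := hl (a%:C *: x + (- 1)%:C *: y).
rewrite !mulmxDr -!scalemxAr -/y !rdot_vnorm2D !vnorm2Z !(rdotDl, rdotDr, rdotZl, rdotZr).
rewrite (hh x y) -/y !rdotxx => h1 h2.
by rewrite -(ler_pM2l a0); nra.
Qed.

End Vectors.

(** * Rank-one pencils *)

Section RankOneDet.

(* Schur complement of the 1 x 1 corner in the block matrix [N, -u; x w, 1],
   whose last row is affine in x. *)
Lemma det_rank1_affine (K : comPzRingType) d (N : 'M[K]_d) (u : 'cV_d) (w : 'rV_d) (x : K) :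
  \det (N + x *: (u *m w)) = \det N + x * (\det (N + u *m w) - \det N).
Proof.
pose B y : 'M_(d + 1) := block_mx N (- u) (y *: w) 1%:M.
have detB y : \det (B y) = \det (N + y *: (u *m w)).
  have e : B y *m block_mx 1%:M 0 (- (y *: w)) 1%:M = block_mx (N + y *: (u *m w)) (- u) 0 1%:M.
    rewrite mulmx_block !mulmx1 !mulmx0 !mul1mx !add0r subrr.
    by rewrite mulNmx mulmxN opprK scalemxAr.
  by have := congr1 determinant e; rewrite det_mulmx det_lblock det_ublock !det1 !mulr1.
have lin : \det (B x) = x * \det (B 1) + (1 - x) * \det (B 0).
  apply: (determinant_multilinear (i0 := rshift d 0)).
  - apply/rowP => j; rewrite !mxE; case: splitP => k /= kE; first by have := ltn_ord k; lia.
    by rewrite !mxE; case: splitP => l _; rewrite !mxE; ring.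
  - apply/matrixP => i j; rewrite !mxE; case: splitP => k kE; rewrite ?mxE //.
    by have /eqP[] := neq_lift (rshift d 0) i; apply: val_inj; apply: etrans (esym kE); rewrite (ord1 k).
  - apply/matrixP => i j; rewrite !mxE; case: splitP => k kE; rewrite ?mxE //.
    by have /eqP[] := neq_lift (rshift d 0) i; apply: val_inj; apply: etrans (esym kE); rewrite (ord1 k).
rewrite -detB lin !detB scale1r scale0r addr0; ring.
Qed.

Lemma det_neq0_inj (K : fieldType) d (M : 'M[K]_d) :
  (forall x : 'cV_d, x != 0 -> M *m x != 0) -> \det M != 0.
Proof.
move=> h; apply/negP; rewrite -det_tr => /det0P[v v0 vM].
have := h v^T; rewrite -(inj_eq trmx_inj) trmxK trmx0 => /(_ v0).
by rewrite -(inj_eq trmx_inj) trmx_mul trmxK vM trmx0 eqxx.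
Qed.

Lemma det_eq0_ker (K : fieldType) d (M : 'M[K]_d) (x : 'cV_d) :
  x != 0 -> M *m x = 0 -> \det M = 0.
Proof.
move=> x0 Mx; apply/eqP; rewrite -det_tr; apply/det0P; exists x^T.
  by rewrite -(inj_eq trmx_inj) trmxK trmx0.
by rewrite -trmx_mul Mx trmx0.
Qed.

End RankOneDet.

Section Pencil.
Context {R : realType} {n d : nat} (a : R) (u : 'I_n -> 'cV[R[i]]_d).
Hypothesis a_gt0 : 0 < a.

Definition pencil (v : 'I_n -> R[i]) : 'M[R[i]]_d :=
  (a%:C)%:M + \sum_i v i *: rk1 (u i).

Lemma pencil_upd v i x : pencil (upd v i x) = pencil (upd v i 0) + x *: rk1 (u i).
Proof.
rewrite /pencil (bigD1 i) //= [in RHS](bigD1 i) //= !upd_same scale0r add0r -addrA.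
rewrite [x *: _ + _]addrC; congr (_ + (_ + _)); apply: eq_bigr => k ki.
by rewrite !upd_other.
Qed.

Lemma multiaffine_det_pencil : multiaffine (fun v => \det (pencil v)).
Proof.
move=> v i x; rewrite /dif (pencil_upd v i x) (pencil_upd v i 1).
by rewrite scale1r /rk1 det_rank1_affine.
Qed.

Lemma dot_pencil v x : dot x (pencil v *m x) =
  (a * vnorm2 x)%:C + \sum_i v i * (dot2 (u i) x)%:C.
Proof.
rewrite mulmxDl dotDr mul_scalar_mx dotZr dot_vnorm2 -rmorphM; congr (_ + _).
rewrite mulmx_suml /dot mulmx_sumr summxE; apply: eq_bigr => i _.
by rewrite -scalemxAl -[LHS]/(dot x _) dotZr dot_rk1.
Qed.

Lemma rdot_pencil q x : rdot x (pencil (toC q) *m x) =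
  a * vnorm2 x + \sum_i q i * dot2 (u i) x.
Proof.
rewrite /rdot dot_pencil raddfD /= raddf_sum; congr (_ + _).
by apply: eq_bigr => i _; exact: Re_mulC.
Qed.

Lemma adjmx_pencil q : adjmx (pencil (toC q)) = pencil (toC q).
Proof.
apply/matrixP => k l; rewrite /adjmx !mxE !summxE rmorphD rmorph_sum /=.
congr (_ + _); first by rewrite eq_sym; case: eqP => _; rewrite ?conjc0 ?conjc_real.
apply: eq_bigr => i _; rewrite [in LHS]mxE [in RHS]mxE rmorphM /=; congr (_ * _); first exact: conjc_real.
by rewrite -{2}(adjmx_rk1 (u i)) !mxE.
Qed.

Lemma det_pencil_real q : complex.Im (\det (pencil (toC q))) = 0.
Proof.
have : \det (pencil (toC q)) = conjc (\det (pencil (toC q))).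
  by rewrite -{1}adjmx_pencil det_tr det_map_mx.
by case: (\det _) => b c [h] /=; lra.
Qed.

(** For a kernel vector x, the imaginary part of x^* M x forces every u_i^* x to vanish, and what
    remains is a |x|^2 = 0. *)
Lemma det_pencil_neq0 v : (forall k, 0 < complex.Im (v k)) -> \det (pencil v) != 0.
Proof.
move=> vp; apply: det_neq0_inj => x x0; apply/eqP => Mx.
have := dot_pencil v x; rewrite Mx /dot mulmx0 mxE => /esym h.
have hI : \sum_i complex.Im (v i) * dot2 (u i) x = 0.
  have := congr1 (@complex.Im R) h; rewrite raddfD raddf_sum /= add0r => {2}<-.
  apply: eq_bigr => i _; apply/esym/(etrans _ (mulrC _ _)).
  by rewrite /= [v i * _]mulrC Im_mulC.
have w0 i : dot2 (u i) x = 0.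
  have := hI => /eqP; rewrite psumr_eq0 => [/allP/(_ i (mem_index_enum i))/=|k _].
    by rewrite mulf_eq0 gt_eqF //= => /eqP.
  by rewrite mulr_ge0 ?dot2_ge0 // ltW.
move: h; rewrite big1 ?addr0 => [[h]|i _]; last by rewrite w0 mulr0.
by have := mulr_gt0 a_gt0 (vnorm2_gt0 x0); rewrite h ltxx.
Qed.

Lemma det_pencil_pd_neq0 q : (forall x, x != 0 -> 0 < a * vnorm2 x + \sum_i q i * dot2 (u i) x) ->
  \det (pencil (toC q)) != 0.
Proof.
move=> h; apply: det_neq0_inj => x x0; apply/eqP => Mx.
by have := h x x0; rewrite -rdot_pencil Mx /rdot /dot mulmx0 mxE ltxx.
Qed.

Definition rdet (q : 'I_n -> R) : R := realpart (fun v => \det (pencil v)) q.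

Lemma rdet_neq0 q : (rdet q != 0) = (\det (pencil (toC q)) != 0).
Proof.
by rewrite /rdet /realpart eq_complex det_pencil_real eqxx andbT.
Qed.

Lemma multiaffine_rdet : multiaffine rdet.
Proof. exact/multiaffine_realpart/multiaffine_det_pencil. Qed.

Lemma rdet0 : 0 < rdet (fun=> 0).
Proof.
rewrite /rdet /realpart /pencil big1 => [|i _]; last by rewrite /toC scale0r.
by rewrite addr0 det_scalar -rmorphXn /= exprn_gt0.
Qed.

(** The determinant is positive at the origin. On a coordinatewise path from there to [q], which
    stays above [p] because p <= 0, a change of sign would produce a zero. *)
Lemma above_rdet p : (forall k, p k <= 0) ->
  (forall q, (forall k, p k <= q k) -> rdet q != 0) -> above rdet p.
Proof.
move=> p0 nz q pq.
apply: (@upd_ind _ _ (fun q => 0 < rdet q) (fun=> 0) q) => [|v i vb vi vp]; first exact: rdet0.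
rewrite ltNge; apply/negP => le0.
have := taylor v i (q i - v i) multiaffine_rdet; rewrite addrC subrK => qE.
set D := dif rdet i v in qE.
have DE : rdet v - rdet (upd v i (q i)) = - ((q i - v i) * D) by rewrite qE; ring.
have pos : 0 < - ((q i - v i) * D) by lra.
(* The zero of the affine restriction to the segment. *)
pose t := rdet v / - ((q i - v i) * D).
have t0 : 0 <= t by rewrite divr_ge0 // ltW.
have t1 : t <= 1 by rewrite ler_pdivrMr // mul1r; lra.
have pv k : p k <= v k by case: (vb k) => ->.
have : rdet (upd v i (v i + t * (q i - v i))) != 0.
  apply: nz => k; rewrite /upd; case: eqP => [->|//].
  have := pq i; have := p0 i; rewrite vi; nra.
rewrite taylor; last exact: multiaffine_rdet.
have tE : t * - ((q i - v i) * D) = rdet v by rewrite divfK // gt_eqF.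
rewrite -/D; apply/negP; rewrite negbK; apply/eqP; lra.
Qed.

(** Along coordinate [j] the only zero lies at distance f / f_j below [p], so a zero-free stretch of
    length 1 / phi bounds f_j / f by [phi]. Writing y phi < 1 allows phi = 0. *)
Lemma dif_rdet_le p j phi : above rdet p -> 0 <= phi ->
  (forall y, 0 <= y -> y * phi < 1 -> rdet (upd p j (p j - y)) != 0) ->
  dif rdet j p <= phi * rdet p.
Proof.
move=> ap phi0 nz; rewrite leNgt; apply/negP => h.
have pp : 0 < rdet p by exact: ap.
have D0 : 0 < dif rdet j p by apply: le_lt_trans h; rewrite mulr_ge0 // ltW.
have y0 : 0 <= rdet p / dif rdet j p by rewrite divr_ge0 // ltW.
have y1 : rdet p / dif rdet j p * phi < 1.
  by rewrite mulrAC ltr_pdivrMr // mul1r mulrC.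
have := nz _ y0 y1; rewrite taylor; last exact: multiaffine_rdet.
by rewrite mulNr divfK ?subrr ?eqxx // gt_eqF.
Qed.

Lemma pencil_shift q i t :
  pencil (toC (upd q i (q i + t))) = pencil (toC q) + t%:C *: rk1 (u i).
Proof.
rewrite -upd_toC pencil_upd -[in RHS](upd_id (toC q) i) [in RHS]pencil_upd.
by rewrite rmorphD scalerDl addrA.
Qed.

(* If N is positive definite, N g = u and 1 <= t (u^* g), then N - y u u^* is
   singular at y = 1 / (u^* g). *)
Lemma pencil_downdate q i t : 0 <= t ->
    (forall x, x != 0 -> 0 < a * vnorm2 x + \sum_k q k * dot2 (u k) x) ->
    (forall y, 0 <= y -> y <= t -> rdet (upd q i (q i - y)) != 0) ->
  forall x, x != 0 ->
    0 < a * vnorm2 x + \sum_k upd q i (q i - t) k * dot2 (u k) x.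
Proof.
move=> t0 pd nz x x0.
have -> : \sum_k upd q i (q i - t) k * dot2 (u k) x =
    \sum_k q k * dot2 (u k) x - t * dot2 (u i) x.
  rewrite (bigD1 i) //= [in RHS](bigD1 i) //= upd_same mulrBl -!addrA; congr (_ + _).
  by rewrite addrC; congr (_ + _); apply: eq_bigr => k ki; rewrite upd_other.
set N := pencil (toC q).
have detN : \det N != 0 by exact: det_pencil_pd_neq0.
have uN : N \in unitmx by rewrite unitmxE unitfE.
pose g := invmx N *m u i.
have Ng : N *m g = u i by rewrite /g mulKVmx.
have [ui0|ui0] := eqVneq (u i) 0.
  have -> : dot2 (u i) x = 0.
    by apply/eqP; rewrite eq_le dot2_ge0 andbT (le_trans (dot2_le _ _)) // ui0 vnorm20 mul0r.
  by rewrite mulr0 subr0; exact: pd.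
have g0 : g != 0 by apply: contraNneq ui0 => gz; rewrite -Ng gz mulmx0.
have aN : adjmx N = N by exact: adjmx_pencil.
have c0 : 0 < rdot g (N *m g) by rewrite rdot_pencil; exact: pd.
set c := rdot g (N *m g) in c0.
have cE : dot (u i) g = c%:C.
  by rewrite -{1}Ng /c -{1}aN -dot_mulmx (herm_dot_real _ aN).
have tc : t * c < 1.
  rewrite ltNge; apply/negP => tc1.
  have ct : c^-1 <= t by rewrite -[c^-1]mul1r ler_pdivrMr.
  have := nz c^-1; rewrite invr_ge0 ltW // => /(_ isT ct).
  rewrite rdet_neq0 pencil_shift; apply/negP; rewrite negbK; apply/eqP.
  apply: (det_eq0_ker g0).
  rewrite mulmxDl -scalemxAl rk1_mul cE -/N Ng scalerA -rmorphM mulNr mulVf ?gt_eqF //.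
  by rewrite rmorphN scaleN1r subrr.
have psd z : 0 <= rdot z (N *m z).
  have [->|z0] := eqVneq z 0; first by rewrite /rdot /dot mulmx0 mulmx0 mxE; exact: lexx.
  by rewrite rdot_pencil ltW // pd.
(* Since u = N g, this is Cauchy-Schwarz for the form of [N]; together with t c < 1 it keeps the
   downdated form positive. *)
have cs : dot2 (u i) x <= c * rdot x (N *m x).
  have uE : dot (u i) x = dot g (N *m x) by rewrite dot_mulmx aN Ng.
  by rewrite /dot2 uE; exact: cauchy_schwarz.
rewrite rdot_pencil in cs; have := pd x x0 => px.
have := ler_wpM2l t0 cs.
rewrite addrA; nra.
Qed.

End Pencil.

(** * Composition of the steps *)

Section Product.
Context {K : comPzRingType} {J : finType}.
Implicit Types (f g : (J -> K) -> K) (v : J * bool -> K).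

Definition slice b v : J -> K := fun i => v (i, b).

(** The index (i, true) carries z_i and (i, false) carries w_i. *)
Definition prod2 f g v : K := f (slice true v) * g (slice false v).

Lemma slice_upd b v i x : slice b (upd v (i, b) x) = upd (slice b v) i x.
Proof. by apply: funext => k; rewrite /slice /upd xpair_eqE eqxx andbT. Qed.

Lemma slice_upd_neg b v i x : slice (~~ b) (upd v (i, b) x) = slice (~~ b) v.
Proof.
by apply: funext => k; rewrite /slice upd_other // xpair_eqE negb_and; case: b; rewrite orbT.
Qed.

Lemma dif_prod2_true f g v i :
  dif (prod2 f g) (i, true) v = dif f i (slice true v) * g (slice false v).
Proof. by rewrite /dif /prod2 !slice_upd !(slice_upd_neg true) mulrBl. Qed.

Lemma dif_prod2_false f g v i :
  dif (prod2 f g) (i, false) v = f (slice true v) * dif g i (slice false v).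
Proof. by rewrite /dif /prod2 !slice_upd !(slice_upd_neg false) mulrBr. Qed.

Lemma multiaffine_prod2 f g : multiaffine f -> multiaffine g -> multiaffine (prod2 f g).
Proof.
move=> mf mg v [i []] x; rewrite (dif_prod2_true, dif_prod2_false) /prod2 !slice_upd.
  by rewrite !(slice_upd_neg true) mf mulrDl mulrA.
by rewrite !(slice_upd_neg false) mg; ring.
Qed.

End Product.

Section Assembly.
Context {R : realType} {J : finType} (X : J -> finRV R).
Implicit Types (s : seq J) (p : J * bool -> R).

Definition subdifs {K : comPzRingType} (c : J -> K) (F : (J * bool -> K) -> K) s :=
  foldr (fun i G => subdif (c i) (i, true) (i, false) G) F s.

Definition shifted (x : J -> R) p s (j : J * bool) :=
  if j.1 \in s then p j + x j.1 else p j.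

Lemma pair_neq (i : J) : (i, true) != (i, false).
Proof. by rewrite xpair_eqE andbF. Qed.

Lemma stable_subdifs (c : J -> R) F s : (forall i, 0 <= c i) -> stable F ->
  stable (subdifs (fun i => (c i)%:C) F s).
Proof.
move=> c0 sF; elim: s => //= i s IH; apply: stable_subdif => //; exact: pair_neq.
Qed.

Lemma realpart_subdifs (c : J -> R) F s :
  realpart (subdifs (fun i => (c i)%:C) F s) = subdifs c (realpart F) s.
Proof. by elim: s => //= i s IH; rewrite realpart_subdif IH. Qed.

Lemma multiaffine_subdifs (c : J -> R) F s : multiaffine F -> multiaffine (subdifs c F s).
Proof. by move=> mF; elim: s => //= i s; exact: multiaffine_subdif. Qed.

Lemma rayleigh_subdifs (c : J -> R) F s : (forall i, 0 <= c i) -> stable F ->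
  rayleigh (subdifs c (realpart F) s).
Proof.
by move=> c0 sF; rewrite -realpart_subdifs; exact/rayleigh_realpart/stable_subdifs.
Qed.

Section Barriers.
Variables (F : (J * bool -> R[i]) -> R[i]) (c x phi : J -> R) (p : J * bool -> R).
Hypotheses (sF : stable F) (c0 : forall i, 0 <= c i) (x0 : forall i, 0 <= x i).
Hypothesis (cphi : forall i, (c i - x i ^+ 2) * (2 * phi i) <= x i).
Let f := realpart F.
Hypothesis (af : above f p).
Hypothesis (fphi : forall j, dif f j p <= phi j.1 * f p).

(** The bounds [phi] on the ratios of the untouched variables survive each step, so [cphi] yields
    the size condition for the next index; its factor 2 counts z_i and w_i. *)
Lemma above_subdifs_shifted s : uniq s ->
  above (subdifs c f s) (shifted x p s) /\
  forall j, j.1 \notin s ->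
    dif (subdifs c f s) j (shifted x p s) <= phi j.1 * subdifs c f s (shifted x p s).
Proof.
elim: s => [_|i s IH /= /andP[is_ us]].
  by rewrite (_ : shifted x p [::] = p) //; apply: funext.
have [ag gphi] := IH us; set g := subdifs c f s in ag gphi *.
have mg : multiaffine g.
  exact/multiaffine_subdifs/multiaffine_realpart/(stable_multiaffine sF).
have rg : rayleigh g by exact: rayleigh_subdifs.
have -> : shifted x p (i :: s) = shift2 (i, true) (i, false) (shifted x p s) (x i).
  apply: funext => -[k b]; rewrite /shift2 /upd !xpair_eqE /shifted /= inE (negbTE is_).
  by case: eqP => [->|_] /=; case: b.
have gp : 0 < g (shifted x p s) by exact: ag.
have cond : (c i - x i ^+ 2) * (dif g (i, true) (shifted x p s) + dif g (i, false) (shifted x p s))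
   <= x i * g (shifted x p s).
  have d0 : 0 <= dif g (i, true) (shifted x p s) by exact: above_dif mg ag _.
  have d1 : 0 <= dif g (i, false) (shifted x p s) by exact: above_dif mg ag _.
  have [cx|cx] := leP 0 (c i - x i ^+ 2); last first.
    apply: le_trans (mulr_ge0 (x0 i) (ltW gp)); apply: mulr_le0_ge0; first exact: ltW.
    exact: addr_ge0.
  have h1 := gphi (i, true) is_; have h2 := gphi (i, false) is_.
  have h := ler_wpM2r (ltW gp) (cphi i).
  apply: le_trans h; rewrite -mulrA; apply: ler_wpM2l => //=.
  move: h1 h2 => /=; lra.
rewrite /= -/g.
split; first exact: (above_subdif mg rg (pair_neq i) (x0 i) ag cond).
move=> j; rewrite inE negb_or => /andP[ji js].
have jt : j != (i, true) by apply: contraNneq ji => ->.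
have jf : j != (i, false) by apply: contraNneq ji => ->.
have G0 : 0 <= subdif (c i) (i, true) (i, false) g (shift2 (i, true) (i, false) (shifted x p s) (x i)).
  by apply: ltW; apply: (above_subdif mg rg (pair_neq i) _ ag cond).
have := barrier_subdif mg rg (pair_neq i) (x0 i) ag cond jt jf.
have := ler_wpM2r G0 (gphi j js).
by move=> h1 h2; rewrite -(ler_pM2r gp); lra.
Qed.

End Barriers.

Lemma fsupp_head (Y : finRV R) : head 0 (fsupp Y) \in fsupp Y.
Proof.
have := fprob_sum1 Y; case: (fsupp Y) => [|y s _] /=; last by rewrite mem_head.
by rewrite big_nil => /esym/eqP; rewrite oner_eq0.
Qed.

Definition sgnb (b : bool) (e : R) := if b then e else - e.

Lemma greedy_choice F s p : stable F -> uniq s ->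
    above (subdifs (fun i => fvar (X i)) (realpart F) s) p ->
    (forall j, j.1 \in s -> p j = 0) ->
  exists2 eps : J -> R, (forall i, eps i \in fsupp (X i)) &
    above (realpart F) (fun j =>
      if j.1 \in s then sgnb j.2 (eps j.1 - fexp (X j.1)) else p j).
Proof.
move=> sF; have c0 i : 0 <= fvar (X i) by exact: fvar_ge0.
elim: s p => [p _ /= af _|i s IH p /= /andP[is_ us] ag p0].
  (* Any atoms do here: with no index left, all earlier choices are recorded in [p]. *)
  by exists (fun i => head 0 (fsupp (X i))) => // i; exact: fsupp_head.
have mf : multiaffine (subdifs (fun i => fvar (X i)) (realpart F) s).
  exact/multiaffine_subdifs/multiaffine_realpart/(stable_multiaffine sF).
have rf := rayleigh_subdifs s c0 sF.
have [e eX] := greedy_step mf rf (pair_neq i) ag.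
rewrite !p0 ?inE ?eqxx // add0r sub0r => ae.
have [|eps epsX aeps] := IH _ us ae.
  move=> [k b] /= ks; have ki : k != i by apply: contraNneq is_ => <-.
  by rewrite /upd !xpair_eqE (negbTE ki) /= p0 // inE ks orbT.
exists (upd eps i e) => [k|]; first by rewrite /upd; case: eqP => [->|].
apply: above_le aeps _ => -[k b] /=; rewrite inE.
have [->|ki] /= := eqVneq k i.
  by rewrite (negbTE is_) upd_same /upd !xpair_eqE eqxx /=; case: b.
by rewrite upd_other // /upd !xpair_eqE (negbTE ki).
Qed.

End Assembly.

(** * The determinant polynomial and its barrier constants *)

Section Discrepancy.
Context {R : realType} {n d : nat}.
Implicit Types (u : 'I_n -> 'cV[R[i]]_d) (e : 'I_n -> R).

Lemma pencil0 u e : pencil 0 u (toC e) = \sum_i (e i)%:C *: rk1 (u i).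
Proof. by rewrite /pencil raddf0 add0r. Qed.

Lemma realpart_prod2_det (a : R) u :
  realpart (prod2 (fun v => \det (pencil a u v)) (fun v => \det (pencil a u v))) =
  prod2 (rdet a u) (rdet a u).
Proof.
apply: funext => p; rewrite /realpart /prod2 /rdet /realpart.
have := det_pencil_real a u (slice true p); have := det_pencil_real a u (slice false p).
rewrite -![slice _ (toC p)]/(toC (slice _ p)).
case: (\det _) => ? ? /= ->; case: (\det _) => ? ? /= ->; simpc => /=; ring.
Qed.

Lemma stable_prod2_det (a : R) u : 0 < a ->
  stable (prod2 (fun v => \det (pencil a u v)) (fun v => \det (pencil a u v))).
Proof.
move=> a0; split.
- by apply: multiaffine_prod2; exact: multiaffine_det_pencil.
- move=> p; rewrite /prod2 -![slice _ (toC p)]/(toC (slice _ p)).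
  have := det_pencil_real a u (slice true p); have := det_pencil_real a u (slice false p).
  case: (\det _) => ? ? /= ->; case: (\det _) => ? ? /= ->; simpc => /=; ring.
- by move=> v vp; rewrite /prod2 mulf_neq0 //; apply: det_pencil_neq0 => // k; exact: vp.
Qed.

(** The form is positive definite at the positive part of [e]; coordinates are then lowered to [e]
    one by one with [pencil_downdate]. *)
Lemma above_rdet_posdef (a : R) u e : 0 < a ->
    (forall q, (forall k, e k <= q k) -> rdet a u q != 0) ->
  forall x, x != 0 -> 0 < a * vnorm2 x + \sum_k e k * dot2 (u k) x.
Proof.
move=> a0 nz.
pose m k := Num.max (e k) 0.
have em k : e k <= m k by rewrite le_max lexx.
have m0 k : 0 <= m k by rewrite le_max lexx orbT.
apply: (@upd_ind _ _ (fun q => forall x, x != 0 ->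
   0 < a * vnorm2 x + \sum_k q k * dot2 (u k) x) m e).
  move=> x x0; apply: ltr_pwDl; first by rewrite mulr_gt0 // vnorm2_gt0.
  by apply: sumr_ge0 => k _; rewrite mulr_ge0 // dot2_ge0.
move=> q i qb qi pd.
have eq' k : e k <= q k by case: (qb k) => ->.
have := @pencil_downdate _ _ _ a u q i (q i - e i).
rewrite (_ : q i - (q i - e i) = e i); last by ring.
apply=> //; first by rewrite subr_ge0.
move=> y y0 yt; apply: nz => k; rewrite /upd; case: eqP => [->|//]; lra.
Qed.

Lemma above_prod2 (f : ('I_n -> R) -> R) p : above f (slice true p) ->
  above f (slice false p) -> above (prod2 f f) p.
Proof.
move=> h1 h2 q pq; apply: mulr_gt0.
  by apply: h1 => k; exact: (pq (k, true)).
by apply: h2 => k; exact: (pq (k, false)).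
Qed.

Lemma fvar_eq0 (X : finRV R) (e : R) : fvar X = 0 -> e \in fsupp X -> e = fexp X.
Proof.
rewrite /fvar big_seq => /eqP; rewrite psumr_eq0 => [/allP h eX|x xX]; last first.
  by rewrite mulr_ge0 ?sqr_ge0 // ltW // fprob_pos.
have := h e eX; rewrite eX /= mulf_eq0 gt_eqF ?fprob_pos //= sqrf_eq0 subr_eq0.
by move/eqP.
Qed.

Lemma rk1_sqr (v : 'cV[R[i]]_d) : rk1 v *m rk1 v = (vnorm2 v)%:C *: rk1 v.
Proof. by rewrite {2}/rk1 mulmxA rk1_mul dot_vnorm2 -scalemxAl. Qed.

Section Spread.
Variables (u : 'I_n -> 'cV[R[i]]_d) (c : 'I_n -> R) (sg : R).
Hypotheses (c0 : forall i, 0 <= c i) (sg0 : 0 < sg).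
Hypothesis S_le : forall x,
  \sum_i c i * vnorm2 (u i) * dot2 (u i) x <= sg ^+ 2 * vnorm2 x.

(** Since A_i^2 = |u_i|^2 A_i, [S_le] says that the sum of delta_i A_i is at most sg times the
    identity. *)
Let delta i := c i * vnorm2 (u i) / sg.

Let sum_ge q x : (forall k, - delta k <= q k) ->
  - (sg * vnorm2 x) <= \sum_k q k * dot2 (u k) x.
Proof.
move=> qd; apply: (@le_trans _ _ (\sum_k - delta k * dot2 (u k) x)); last first.
  by apply: ler_sum => k _; rewrite ler_wpM2r ?dot2_ge0.
have -> : \sum_k - delta k * dot2 (u k) x =
    - (\sum_k c k * vnorm2 (u k) * dot2 (u k) x) / sg.
  by rewrite -sumrN mulr_suml; apply: eq_bigr => k _; rewrite /delta; field; exact: lt0r_neq0.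
rewrite mulNr lerN2 ler_pdivrMr //.
by rewrite mulrAC -expr2.
Qed.

Let rdet_delta : above (rdet (3 * sg) u) (fun k => - delta k).
Proof.
have a0 : 0 < 3 * sg by rewrite mulr_gt0 // ltr0n.
apply: above_rdet => // [k|q qd].
  by rewrite oppr_le0 /delta divr_ge0 ?mulr_ge0 ?vnorm2_ge0 // ltW.
rewrite rdet_neq0; apply: det_pencil_pd_neq0 => x x0.
by have := sum_ge x qd; have := mulr_gt0 sg0 (vnorm2_gt0 x0); lra.
Qed.

(** The shift by - delta uses one of the three sg. Lowering coordinate [j] by a further y costs at
    most y |u_j|^2 and stays safe below 2 sg. *)
Let dif_rdet_delta j : dif (rdet (3 * sg) u) j (fun k => - delta k) <=
  vnorm2 (u j) / (2 * sg) * rdet (3 * sg) u (fun k => - delta k).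
Proof.
apply: dif_rdet_le => [//||y y0].
  by rewrite divr_ge0 ?vnorm2_ge0 // mulr_ge0 // ltW.
rewrite mulrA ltr_pdivrMr ?mul1r ?mulr_gt0 //.
move=> ys; rewrite rdet_neq0; apply: det_pencil_pd_neq0 => x x0.
have -> : \sum_k upd (fun k => - delta k) j (- delta j - y) k * dot2 (u k) x =
    \sum_k - delta k * dot2 (u k) x - y * dot2 (u j) x.
  rewrite (bigD1 j) //= [in RHS](bigD1 j) //= upd_same mulrBl -!addrA; congr (_ + _).
  by rewrite addrC; congr (_ + _); apply: eq_bigr => k ki; rewrite upd_other.
have N0 := vnorm2_gt0 x0.
have h1 := sum_ge x (fun k => lexx (- delta k)).
have h2 := ler_wpM2l y0 (dot2_le (u j) x).
have : 0 < (2 * sg - y * vnorm2 (u j)) * vnorm2 x by rewrite mulr_gt0 // subr_gt0.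
lra.
Qed.

Lemma above_subdifs0 : above
  (subdifs c (realpart (prod2 (fun v => \det (pencil (3 * sg) u v))
                              (fun v => \det (pencil (3 * sg) u v)))) (enum 'I_n)) (fun=> 0).
Proof.
have a0 : 0 < 3 * sg by rewrite mulr_gt0 // ltr0n.
have d0 i : 0 <= delta i by rewrite /delta divr_ge0 ?mulr_ge0 ?vnorm2_ge0 // ltW.
have rd := rdet_delta (fun k => lexx _).
have [|||ag _] := @above_subdifs_shifted R 'I_n _ c delta
  (fun i => vnorm2 (u i) / (2 * sg)) (fun j => - delta j.1)
  (stable_prod2_det u a0) c0 d0 _ _ _ (enum 'I_n) (enum_uniq _).
(* The remaining 2 sg cancel the factor 2: c_i |u_i|^2 / sg is exactly delta_i. *)
- move=> i; have -> : 2 * (vnorm2 (u i) / (2 * sg)) = vnorm2 (u i) / sg.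
    by field; exact: lt0r_neq0.
  rewrite mulrBl mulrA -/(delta i) gerBl mulr_ge0 ?sqr_ge0 //.
  by rewrite divr_ge0 ?vnorm2_ge0 // ltW.
- by rewrite realpart_prod2_det; apply: above_prod2; exact: rdet_delta.
- move=> [j b]; rewrite realpart_prod2_det /=; case: b.
    rewrite dif_prod2_true /prod2 mulrA; apply: ler_wpM2r; first exact: ltW.
    exact: dif_rdet_delta.
  rewrite dif_prod2_false /prod2 mulrCA; apply: ler_wpM2l; first exact: ltW.
  exact: dif_rdet_delta.
- move: ag; congr above; apply: funext => j.
  by rewrite /shifted mem_enum addNr.
Qed.

End Spread.

End Discrepancy.

Unset Implicit Arguments.

Theorem theorem1p3 (R : realType) (n d : nat) (xi : 'I_n -> finRV R)
    (u : 'I_n -> 'cV[R[i]]_d) :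
  let sigma := Num.sqrt (opnorm (\sum_(i < n)
                  (fvar (xi i))%:C *: (rk1 (u i) *m rk1 (u i)))) in
  exists eps : 'I_n -> R,
    (forall i, eps i \in fsupp (xi i)) /\
    opnorm (\sum_(i < n) (fexp (xi i))%:C *: rk1 (u i)
            - \sum_(i < n) (eps i)%:C *: rk1 (u i)) <= 3 * sigma.
Proof.
set S := \sum_(i < n) _; move=> sigma.
pose c i := fvar (xi i).
have c0 i : 0 <= c i by exact: fvar_ge0.
have SE : S = pencil 0 u (toC (fun i => c i * vnorm2 (u i))).
  rewrite pencil0; apply: eq_bigr => i _.
  by rewrite rk1_sqr scalerA -rmorphM.
have S_le x : \sum_i c i * vnorm2 (u i) * dot2 (u i) x <= sigma ^+ 2 * vnorm2 x.
  have := rdot_mulmx_le S x; rewrite /sigma sqr_sqrtr ?opnorm_ge0 //.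
  by rewrite {1}SE rdot_pencil mul0r add0r.
have diffE (eps : 'I_n -> R) :
    \sum_(i < n) (fexp (xi i))%:C *: rk1 (u i) - \sum_(i < n) (eps i)%:C *: rk1 (u i) =
    pencil 0 u (toC (fun i => fexp (xi i) - eps i)).
  rewrite pencil0 -sumrB; apply: eq_bigr => i _.
  by rewrite -scalerBl -rmorphB.
have : 0 <= sigma by exact: sqrtr_ge0.
(* The barrier divides by sigma, so sigma = 0 is treated apart: then each index has zero variance or
   u_i = 0, and any atoms work. *)
rewrite le_eqVlt => /orP[/eqP sg0|sg0].
  exists (fun i => head 0 (fsupp (xi i))); split=> [i|]; first exact: fsupp_head.
  rewrite -sg0 mulr0 diffE pencil0 big1 => [|i _].
    by apply: opnorm_le => // x; rewrite mul0mx vnorm20 expr0n mul0r.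
  (* Testing at x = u_i makes the i-th term Var(xi_i) times a power of |u_i|. *)
  have := S_le (u i); rewrite -sg0 expr0n mul0r => h.
  have ge0 k : 0 <= c k * vnorm2 (u k) * dot2 (u k) (u i).
    by rewrite !mulr_ge0 ?vnorm2_ge0 ?dot2_ge0.
  have /eqP : \sum_k c k * vnorm2 (u k) * dot2 (u k) (u i) = 0.
    by apply/eqP; rewrite eq_le h sumr_ge0.
  rewrite psumr_eq0 // => /allP/(_ i (mem_index_enum i)) /=.
  rewrite dot2xx -mulrA -exprS mulf_eq0 expf_eq0 /= => /orP[/eqP ci0|/eqP ui0].
    by rewrite -(fvar_eq0 ci0 (fsupp_head _)) subrr scale0r.
  by rewrite (vnorm2_eq0 ui0) /rk1 mul0mx scaler0.
have a0 : 0 < 3 * sigma by rewrite mulr_gt0.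
have [eps epsX] := greedy_choice (stable_prod2_det u a0) (enum_uniq _)
  (above_subdifs0 c0 sg0 S_le) (fun _ _ => erefl).
rewrite realpart_prod2_det => ae; exists eps; split=> //.
pose e i := eps i - fexp (xi i).
(* The z and w coordinates range independently above e and - e; fixing one of them at its corner
   shows that the other determinant factor does not vanish. *)
have nz (q r : 'I_n -> R) : (forall k, e k <= q k) -> (forall k, - e k <= r k) ->
    rdet (3 * sigma) u q * rdet (3 * sigma) u r != 0.
  move=> qe re; apply: lt0r_neq0.
  apply: (ae (fun j => if j.2 then q j.1 else r j.1)) => -[k b] /=.
  by rewrite mem_enum; case: b => /=; [exact: qe|exact: re].
have pos q : (forall k, e k <= q k) -> rdet (3 * sigma) u q != 0.
  by move=> qe; have := nz q (fun k => - e k) qe (fun _ => lexx _); rewrite mulf_eq0 negb_or => /andP[].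
have neg q : (forall k, - e k <= q k) -> rdet (3 * sigma) u q != 0.
  by move=> qe; have := nz e q (fun _ => lexx _) qe; rewrite mulf_eq0 negb_or => /andP[].
have formE x : \sum_k - e k * dot2 (u k) x = - \sum_k e k * dot2 (u k) x.
  by rewrite -sumrN; apply: eq_bigr => k _; rewrite mulNr.
rewrite diffE (_ : (fun i => _) = (fun i => - e i)); last first.
  by apply: funext => i; rewrite opprB.
(* The upper bound on the form comes from positivity at e, the lower bound from positivity at -
   e. *)
apply: opnorm_herm_le => //; first exact: adjmx_pencil.
- move=> x; have [->|x0] := eqVneq x 0.
    by rewrite /rdot /dot mulmx0 mulmx0 mxE vnorm20 mulr0 lexx.
  rewrite rdot_pencil mul0r add0r formE lerNl -subr_ge0 opprK addrC.
  exact/ltW/above_rdet_posdef.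
- move=> x; have [->|x0] := eqVneq x 0.
    by rewrite /rdot /dot mulmx0 mulmx0 mxE vnorm20 mulr0 oppr0 lexx.
  rewrite rdot_pencil mul0r add0r -subr_ge0 opprK addrC.
  exact/ltW/above_rdet_posdef.
Qed.
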